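(* Let $(\mathscr{S},d)$ be a complete metric space, let $f\colon \mathscr{S}\to(-\infty,+\infty]$ be proper and lower semicontinuous, let $u_0\in D(f)$ and $a\in(0,+\infty]$. Let one of the following hold: (a) $\lambda\ge0$, $p_0\in(1,+\infty)$ and $p\in(1,+\infty)$; (b) $\lambda<0$, $p_0\in[2,+\infty)$ and $p\in(1,p_0]$. Suppose that $f$ is $(p_0,\lambda)$-convex. Let $q,q_0$ be the conjugate exponents of $p,p_0$. Then every $u\in\mathrm{CMS}_p([0,a);u_0)$ satisfies the following. (i) The curve $t\mapsto u(t)$ and the map $t\mapsto f(u(t))$ are locally Lipschitz on $(0,a)$, and $u(t)\in D(|\partial^- f|)$ for every $t\in(0,a)$. (ii) The right limits $$(f\circ u)'_+(t):=\lim_{h\downarrow0}\frac{f(u(t+h))-f(u(t))}{h},\qquad |u'_+|(t):=\lim_{h\downarrow0}\frac{d(u(t+h),u(t))}{h}$$ exist for every $t\in(0,a)$ and satisfy, for every $t\in(0,a)$, $$(f\circ u)'_+(t)=-|\partial^- f|(u(t))\,|u'_+|(t)=-|u'_+|^p(t)=-|\partial^- f|^q(u(t)),\qquad(\ast)$$ and they are almost right continuous in the sense that there exists $A\subset[0,a)$ of full $\mathscr{L}$-measure in $[0,a)$ with $$\lim_{A\ni t'\downarrow t}|\partial^- f|(u(t'))=|\partial^- f|(u(t))\quad\text{for every }t\in(0,a).\qquad(\ast\ast)$$ In addition, if $u_0\in D(|\partial^- f|)$, then $(\ast)$ and $(\ast\ast)$ hold at $t=0$. Moreover, if $\lambda\ge0$,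 then $|\partial^- f|\circ u$ is non-increasing and right continuous on $[0,a)$. (iii) If $\lambda\ge0$, then for all $t_0,t\in[0,a)$ with $t_0<t$ $$|\partial^- f|^q(u(t))\le\frac{f(u(t_0))-\inf_{\mathscr{S}}f}{t-t_0},\qquad \frac1q|\partial^- f|^q(u(t))\le\frac{f(u(t_0))-f_{t-t_0}(u(t_0))}{t-t_0},$$ where $f_\tau(v):=\inf_{w\in\mathscr{S}}\left\{f(w)+\frac{1}{p\,\tau^{p-1}}d^p(v,w)\right\}$ for $\tau>0$. (iv) If $\lambda>0$, then, denoting by $\bar u$ the (existing) unique minimizer of $f$, for any $t\in(0,a)$ $$\lambda d^{p_0}(u(t),\bar u)\le f(u(t))-f(\bar u)\le\frac{1}{q_0\lambda^{q_0/p_0}}|\partial^- f|^{q_0}(u(t)).$$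
   Context: $D(f):=\{v\in\mathscr{S}: f(v)<+\infty\}$; proper means $D(f)\neq\emptyset$. $\mathscr{L}$ is Lebesgue measure. The local slope is $|\partial^- f|(v):=\limsup_{w\to v}\frac{(f(v)-f(w))^+}{d(v,w)}$ if $v\in D(f)$ and $+\infty$ otherwise, where $r^+=\max\{r,0\}$; $D(|\partial^- f|):=\{v: |\partial^- f|(v)<+\infty\}$. Continuity of $|\partial^- f|\circ u$ is meant with values in $[0,+\infty]$. For $a\in(0,+\infty]$, $AC_{loc}([0,a);\mathscr{S})$ is the set of curves $u\colon[0,a)\to\mathscr{S}$ for which there is $m\in L^1_{loc}([0,a))$ (integrable on compact subsets of $[0,a)$) with $d(u(s),u(t))\le\int_s^t m(r)\,dr$ for all $s\le t$ in $[0,a)$; for such $u$ the metric derivative $|u'|(t):=\lim_{s\to t}\frac{d(u(t),u(s))}{|t-s|}$ exists for $\mathscr{L}$-a.e. $t$. Let $p\in(1,+\infty)$ with conjugate exponent $q$ ($1/p+1/q=1$). A curve $u\in AC_{loc}([0,a);\mathscr{S})$ is a $p$-curve of maximal slope for $f$ starting from $u_0\in D(f)$ if $u(0)=u_0$, $f\circ u$ is non-increasing, and $(f\circ u)'(t)\le-\frac1p|u'|^p(t)-\frac1q|\partial^- f|^q(u(t))$ for $\mathscr{L}$-a.e. $t\in[0,a)$. $\mathrm{CMS}_p([0,a);u_0)$ denotes the set of all such curves defined on $[0,a)$. $f$ is $(p,\lambda)$-convex ($p\in(1,+\infty)$, $\lambda\in\mathbb{R}$) if there is $\psi\colon[0,1]\to[0,1]$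 with $\lim_{t\downarrow0}\psi(t)=0$ and $\psi(t)<1$ for some $t\in(0,1)$, such that for any $v_0,v_1\in\mathscr{S}$ there is a curve (continuous map) $\gamma\colon[0,1]\to\mathscr{S}$ from $v_0$ to $v_1$ with $d(\gamma_t,\gamma_0)\le t\,d(\gamma_1,\gamma_0)$ and $f(\gamma_t)\le(1-t)f(\gamma_0)+tf(\gamma_1)-\lambda t(1-\psi(t))d^p(\gamma_0,\gamma_1)$ for every $t\in[0,1]$. *)

(* Defs.v *)
From HB Require Import structures.
From mathcomp Require Import all_boot all_order all_algebra.
From mathcomp Require Import all_classical all_reals all_analysis.

Set Implicit Arguments.
Unset Strict Implicit.
Unset Printing Implicit Defensive.

Import Order.TTheory GRing.Theory Num.Theory.
Import numFieldNormedType.Exports.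

Local Open Scope classical_set_scope.
Local Open Scope ring_scope.

(* The point carried by the library's completeType costs no generality for a
   space that is the domain of a proper function. *)
#[short(type="completeMetricType")]
HB.structure Definition CompleteMetric (K : numDomainType) :=
  {T of CompletePseudoMetric K T & Metric K T}.

Section Functionals.
Context {R : realType} {S : metricType R}.
Implicit Types (f g : S -> \bar R) (p lambda tau : R).

Definition edom g : set S := [set v | (g v < +oo)%E].

Definition eproper f : Prop := edom f !=set0.

(* The limsup runs over w != v. The outer maximum only matters at an isolated
   point v, where the limsup over the empty set of competitors, -oo as computed
   by limf_esup, is read as 0. *)
Definition local_slope f (v : S) : \bar R :=
  if (f v < +oo)%E then
    (maxe 0 (limf_esup
      (fun w => maxe (f v - f w) 0 * ((mdist v w)^-1)%:E) v^'))%E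
  else +oo%E.

(* Values of f may be +oo; in \bar R one has 0 * +oo = 0, so the upper bound
   reads f v0 at t = 0 and f v1 - lambda (1 - psi 1) d^p at t = 1. *)
Definition plambda_convex p lambda f : Prop :=
  exists psi : R -> R,
  [/\ forall t : R, 0 <= t <= 1 -> 0 <= psi t <= 1,
      psi t @[t --> 0^'+] --> (0 : R),
      (exists2 t : R, 0 < t < 1 & psi t < 1) &
      forall v0 v1 : S, exists gam : R -> S,
      [/\ {within `[0, 1], continuous gam}, gam 0 = v0, gam 1 = v1 &
          forall t : R, 0 <= t <= 1 ->
            mdist (gam t) (gam 0) <= t * mdist (gam 1) (gam 0) /\
            (f (gam t) <= (1 - t)%:E * f (gam 0%R) + t%:E * f (gam 1%R)
               - (lambda * t * (1 - psi t)
                  * mdist (gam 0) (gam 1) `^ p)%:E)%E]].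

Definition moreau_yosida p f tau (v : S) : \bar R :=
  ereal_inf
    [set (f w + (mdist v w `^ p / (p * tau `^ (p - 1)))%:E)%E | w in setT].

Definition minimizer f (v : S) : Prop := forall w, (f v <= f w)%E.

End Functionals.

Section Curves.
Context {R : realType}.

(* [0, a) and (0, a) for a in (0, +oo] *)
Definition co_itv (a : \bar R) : set R := [set t | 0 <= t /\ (t%:E < a)%E].
Definition oo_itv (a : \bar R) : set R := [set t | 0 < t /\ (t%:E < a)%E].

Definition locally_lipschitz (T : metricType R) (g : R -> T) (A : set R) : Prop :=
  forall t, A t -> exists L : R, exists2 V, nbhs t V &
    forall s1 s2, (A `&` V) s1 -> (A `&` V) s2 ->
      mdist (g s1) (g s2) <= L * `|s1 - s2|.

(* A curve [0, a) -> S is a function R -> S of which only the values on [0, a)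
   are ever used. *)
Context {S : metricType R}.
Implicit Types (f : S -> \bar R) (u : R -> S) (a : \bar R) (p q t : R).

Definition AC_loc a u : Prop :=
  exists m : R -> R,
    (forall K, compact K -> K `<=` co_itv a ->
       lebesgue_measure.-integrable K (EFin \o m)) /\
    (forall s t, co_itv a s -> co_itv a t -> s <= t ->
       mdist (u s) (u t) <= \int[lebesgue_measure]_(r in `[s, t]) m r).

Definition is_metric_derivative u t (l : R) : Prop :=
  mdist (u t) (u s) / `|t - s| @[s --> t^'] --> l.

(* f \o u as a real function: for u in CMS it is finite on [0, a), since
   f (u 0) < +oo and f \o u is non-increasing. *)
Definition real_energy f u : R -> R := fun t => fine (f (u t)).

Definition CMS p q f a (u0 : S) u : Prop :=
  [/\ AC_loc a u,
      u 0 = u0,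
      (forall s t, co_itv a s -> co_itv a t -> s <= t -> (f (u t) <= f (u s))%E) &
      {ae lebesgue_measure, forall t, co_itv a t ->
         derivable (real_energy f u) t 1 /\
         exists2 l : R, is_metric_derivative u t l &
           ((derive1 (real_energy f u) t)%:E
              <= - (p^-1 * l `^ p)%:E - (q^-1)%:E * local_slope f (u t) `^ q)%E}].

Definition is_right_derivative (g : R -> R) t (l : R) : Prop :=
  (g (t + h) - g t) / h @[h --> 0^'+] --> l.

Definition is_right_metric_derivative u t (l : R) : Prop :=
  mdist (u (t + h)) (u t) / h @[h --> 0^'+] --> l.

Definition right_energy_identity p q f u t : Prop :=
  exists df du : R,
  [/\ is_right_derivative (real_energy f u) t df,
      is_right_metric_derivative u t du,
      (df%:E = - (local_slope f (u t) * du%:E))%E,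
      (df%:E = - (du `^ p)%:E)%E &
      (df%:E = - (local_slope f (u t) `^ q))%E].

Definition slope_right_cvg f u (A : set R) t : Prop :=
  local_slope f (u t') @[t' --> within A t^'+] --> local_slope f (u t).

End Curves.

(* Main.v *)
Require Import Defs.
From mathcomp Require Import all_boot all_order all_algebra.
From mathcomp Require Import all_classical all_reals all_analysis.
From mathcomp Require Import ring lra.

Set Implicit Arguments.
Unset Strict Implicit.
Unset Printing Implicit Defensive.

Import Order.TTheory GRing.Theory Num.Theory.
Import numFieldNormedType.Exports.

Local Open Scope classical_set_scope.
Local Open Scope ring_scope.

(** The energy [E t = f (u t)] of a curve of maximal slope is only known to be
    nonincreasing, with [E' <= - |u'|^p / p - G^q / q] almost everywhere, where
    [G t] is the slope of [f] at [u t]. Everything follows from an opposite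
    estimate for [E] and from a comparison of the two over short intervals.

    Convexity makes the slope a global quantity: sliding from [v] towards [w]
    along the curve provided by the definition shows
    [f v - f w <= |df|(v) d(v,w) - lambda d(v,w)^p0] for every [w]
    ([slope_global]). The slope is therefore lower semicontinuous
    ([local_slope_lsc]). At almost every time the definition of the slope also
    gives [- E' <= G |u'|], so equality holds in Young's inequality and
    [- E' = |u'|^p = G^q] ([CMS_regular]).

    Pointwise information is integrated with a single tool, [upper_ac_le]: a
    function whose increments are bounded by the integral of an integrable
    function, and whose right upper derivative is almost everywhere at most 0,
    does not increase. It covers both the absolutely continuous curve [u] and
    the monotone function [E], for which no absolute continuity is known. With
    [D = E s - E t] and [h = t - s] it yields
      [D >= c h] as soon as [G^q >= c] on [(s,t)] ([energy_drop_ge]), and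
      [d(u s, u t)^p <= D h^(p-1)] ([dist_powR_le]).
    Inserting the second bound in the global slope inequality and using Young's
    inequality gives [D (1 - k h^(p-1)) <= G(s)^q h]
    ([energy_drop_le_slope_power]), where [k] vanishes if [lambda >= 0]; the
    assumption [p <= p0] is what makes the error term [d^p0] comparable to
    [d^p] when [lambda < 0].

    The heart of the proof is [slope_power_growth]:
    [G(t)^q (1 - B h^(p-1)) <= G(s)^q] for [s < t] close to each other. If it
    failed, consider the last time [r] in [[s,t]] at which [G^q] lies below the
    barrier [c (1 - B (t - .)^(p-1))]. It exists by lower semicontinuity, and
    after [r] the slope lies above the barrier, so the energy lost on [[r,t]] is
    at least a lower sum of the barrier, which for large [B] exceeds the upper
    bound for the energy lost in terms of [G(r)^q]. Since [G] is finite at some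
    time in every interval, this gives finiteness, local boundedness (hence
    local Lipschitz continuity of [u] and [E]) and right continuity of [G]; if
    [k = 0] then [B] may be taken arbitrarily small and [G] is nonincreasing.
    Wherever [G] is finite, the right derivatives come from squeezing [D / h]
    between the lower bound supplied by semicontinuity and the upper bound
    above. As [G] is right continuous at every point, the set of full measure in
    the statement can be taken to be the whole interval.

    If [lambda > 0], the global slope inequality at a point of finite slope
    bounds [f] from below, and uniform convexity makes the sublevel sets of [f]
    near its infimum small; completeness yields the minimizer. *)

(** * Conjugate exponents and powers *)

Section exponents.
Context {R : realType} (p q : R).
Hypothesis p1 : 1 < p.

Lemma exponent_gt0 : 0 < p. Proof. by rewrite (lt_trans _ p1). Qed.

Hypothesis pq : p^-1 + q^-1 = 1.

Lemma conj_exponent_gt0 : 0 < q.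
Proof.
rewrite -invr_gt0.
have : p^-1 < 1 by rewrite invf_lt1 ?exponent_gt0.
by move: pq; lra.
Qed.

Lemma conj_exponent_gt1 : 1 < q.
Proof.
have q0 := conj_exponent_gt0; rewrite -(invf_lt1 q0).
have : 0 < p^-1 by rewrite invr_gt0 exponent_gt0.
by move: pq; lra.
Qed.

Lemma conj_exponentE : (p - 1) * q = p.
Proof.
have pn0 : p != 0 by rewrite gt_eqF// exponent_gt0.
have qn0 : q != 0 by rewrite gt_eqF// conj_exponent_gt0.
have : p * q * (p^-1 + q^-1) = p * q by rewrite pq mulr1.
by rewrite mulrDr mulrAC divff// mul1r mulfK//; lra.
Qed.

End exponents.

Lemma powR_small (R : realType) (al e : R) : 0 < al -> 0 < e ->
  exists2 d : R, 0 < d & forall h, 0 <= h -> h < d -> h `^ al < e.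
Proof.
move=> al0 e0; exists (e `^ al^-1); first exact: powR_gt0.
move=> h h0 hd.
have : h `^ al < (e `^ al^-1) `^ al.
  by rewrite gt0_ltr_powR// ?nnegrE ?powR_ge0.
by rewrite -powRrM mulVf ?gt_eqF// powRr1// ltW.
Qed.

Lemma powR_near0 (R : realType) (al k e : R) : 0 < al -> 0 <= k -> 0 < e ->
  \forall h \near 0^'+, k * h `^ al < e.
Proof.
move=> al0 k0 e0.
have k10 : 0 < k + 1 by lra.
have [|d d0 dP] := @powR_small _ al (e / (k + 1)) al0; first by rewrite divr_gt0.
near=> h.
have h0 : 0 < h by near: h; exact: nbhs_right_gt.
have hd : h < d by near: h; exact: nbhs_right_lt.
have := dP h (ltW h0) hd; rewrite ltr_pdivlMr//.
have := powR_ge0 h al; lra.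
Unshelve. all: end_near.
Qed.

Lemma powR_half_lt1 (R : realType) (al : R) : 0 < al -> 2^-1 `^ al < 1.
Proof.
move=> al0; rewrite [ltRHS](_ : 1 = 1 `^ al); last by rewrite powR1.
by apply: gt0_ltr_powR; rewrite ?nnegrE ?invr_ge0// invf_lt1// ltr1n.
Qed.

Lemma poweR_lt (R : realType) (q c : R) (x : \bar R) : 0 < q -> 0 <= c -> (0 <= x)%E ->
  ((c `^ q)%:E < x `^ q)%E = (c%:E < x)%E.
Proof.
move=> q0 c0; case: x => [g|_|//]; last first.
  by rewrite poweRyr ?gt_eqF// !ltry.
rewrite lee_fin => g0; rewrite !poweR_EFin !lte_fin; apply/idP/idP.
  rewrite !ltNge; apply: contra => gc.
  by apply: ge0_ler_powR; rewrite ?nnegrE// ltW.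
by apply: gt0_ltr_powR; rewrite ?nnegrE.
Qed.

(** The equality case of Young's inequality: [x] minimizes
    [s |-> s^p / p - s y] over the positive reals, so the derivative
    [x^(p-1) - y] vanishes. *)
Lemma young_eq (R : realType) (p q x y : R) : 1 < p -> p^-1 + q^-1 = 1 ->
  0 <= x -> 0 <= y -> x `^ p / p + y `^ q / q <= x * y -> x `^ p = y `^ q.
Proof.
move=> p1 pq x0 y0 xy.
have pp := exponent_gt0 p1; have q0 := conj_exponent_gt0 p1 pq.
move: x0; rewrite le_eqVlt => /predU1P[x0|x0].
  move: xy; rewrite -x0 powR0 ?gt_eqF// !mul0r add0r => yq.
  by apply/esym/eqP; rewrite eq_le powR_ge0 andbT -(ler_pM2r (x := q^-1)) ?invr_gt0// mul0r.
have x10 : 0 <= x + 1 by lra.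
have xin : x \in `]0, (x + 1)[ by rewrite in_itv/= x0; lra.
pose F (s : R) := s `^ p / p - s * y.
have dF (s : R) : 0 < s -> is_derive s 1 F (p * s `^ (p - 1) / p - y).
  move=> s0; have dpow := is_derive1_powR p s0.
  rewrite /F; apply: is_derive_eq.
  by rewrite !scaler0 !add0r /GRing.scale/= mulr1 mulrC.
have dx0 : is_derive x 1 F 0.
  apply: (derive1_at_min x10 _ xin) => s; rewrite in_itv/= => /andP[s0 _].
    by have [] := dF s s0.
  have := conjugate_powR (ltW s0) y0 pp q0 pq; rewrite /F; lra.
have : p * x `^ (p - 1) / p - y = 0.
  have <- := @derive_val _ _ _ _ _ _ _ (dF x x0).
  by rewrite (@derive_val _ _ _ _ _ _ _ dx0).
rewrite mulrAC divff ?gt_eqF// mul1r => /subr0_eq <-.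
by rewrite -powRrM (conj_exponentE p1 pq).
Qed.

(** The maximum over [d] of a linear function minus a power, up to a constant:
    Young's inequality for the product of [lam^(1/p) d] and [lam^(-1/p) g],
    followed by [1 / p <= 1]. *)
Lemma young_le (R : realType) (lam p q g d : R) : 1 < p -> p^-1 + q^-1 = 1 ->
  0 < lam -> 0 <= g -> 0 <= d ->
  g * d - lam * d `^ p <= (q * lam `^ (q / p))^-1 * g `^ q.
Proof.
move=> p1 pq l0 g0 d0.
have pp := exponent_gt0 p1; have q0 := conj_exponent_gt0 p1 pq.
have := @conjugate_powR _ (d * lam `^ p^-1) (g * lam `^ (- p^-1)) p q.
rewrite !mulr_ge0 ?powR_ge0// => /(_ isT isT pp q0 pq).
have -> : d * lam `^ p^-1 * (g * lam `^ (- p^-1)) = g * d.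
  by rewrite powRN mulrACA mulfV ?mulr1 1?mulrC// gt_eqF// powR_gt0.
rewrite !powRM ?powR_ge0// -!powRrM mulVf ?gt_eqF// powRr1 ?(ltW l0)//.
have -> : lam `^ (- p^-1 * q) = (lam `^ (q / p))^-1 by rewrite -powRN; congr (_ `^ _); lra.
have : d `^ p * lam / p <= lam * d `^ p.
  rewrite mulrC [_ * lam]mulrC ler_piMl ?mulr_ge0 ?powR_ge0 ?(ltW l0)//.
  by rewrite invf_le1// ltW.
rewrite invfM.
have -> : q^-1 * (lam `^ (q / p))^-1 * g `^ q = g `^ q / lam `^ (q / p) / q.
  by rewrite mulrC [q^-1 * _]mulrC mulrA.
lra.
Qed.

(** * Limits and intervals *)

Lemma cvgr_between (R : realType) (T : Type) (F : set_system T) (FF : Filter F)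
    (f : T -> R) (l : R) :
  (forall c, c < l -> \forall x \near F, c < f x) ->
  (forall c, l < c -> \forall x \near F, f x < c) -> f @ F --> l.
Proof.
move=> lo up; apply/cvgrPdist_lt => e e0; near=> x.
have : l - e < f x by near: x; apply: lo; lra.
have : f x < l + e by near: x; apply: up; lra.
by move=> ? ?; rewrite ltr_norml; apply/andP; split; lra.
Unshelve. all: end_near.
Qed.

Lemma cvge_between (R : realType) (T : Type) (F : set_system T) (FF : Filter F)
    (f : T -> \bar R) (l : \bar R) : (0 <= l)%E ->
  (forall c : R, (c%:E < l)%E -> \forall x \near F, (c%:E < f x)%E) ->
  (forall c : R, (l < c%:E)%E -> \forall x \near F, (f x < c%:E)%E) -> f @ F --> l.
Proof.
case: l => [l _ lo up|_ lo _|//]; last first.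
  by apply/cvgeyPgt => c; apply: lo; rewrite ltry.
move=> A /= [e /= e0 eA].
have := lo (l - e); rewrite lte_fin => /(_ ltac:(lra)).
have := up (l + e); rewrite lte_fin => /(_ ltac:(lra)).
apply: filterS2 => x lo1 up1; suff : A (f x) by [].
move: lo1 up1; case: (f x) => [r|//|//]; rewrite !lte_fin => r1 r2.
by apply: eA; rewrite /ball/= ltr_norml; apply/andP; split; lra.
Qed.

Lemma near_at_right_shift (R : realType) (P : R -> Prop) (t : R) :
  (\forall s \near t^', P s) -> \forall h \near 0^'+, P (t + h).
Proof.
move=> [d /= d0 dP]; exists d => //= h /= hd h0; apply: dP.
  by rewrite /= opprD addNKr normrN; move: hd; rewrite /= sub0r normrN.
by rewrite -subr_eq0 addrAC subrr add0r gt_eqF.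
Qed.

Lemma co_itv_le (R : realType) (a : \bar R) (s t : R) :
  co_itv a t -> 0 <= s -> s <= t -> co_itv a s.
Proof. by move=> [t0 ta] s0 st; split => //; rewrite (le_lt_trans _ ta)// lee_fin. Qed.

Lemma oo_itv_co (R : realType) (a : \bar R) (t : R) : oo_itv a t -> co_itv a t.
Proof. by move=> [t0 ta]; split => //; exact: ltW. Qed.

Lemma co_itv_right (R : realType) (a : \bar R) (t : R) : co_itv a t ->
  exists2 T, co_itv a T & t < T.
Proof.
move=> [t0]; case: a => [a|_|//].
  rewrite lte_fin => ta; exists ((t + a) / 2); last lra.
  by split; rewrite ?lte_fin; lra.
by exists (t + 1); [split; rewrite ?ltry//; lra | lra].
Qed.

Lemma near_right_co (R : realType) (a : \bar R) (t : R) : co_itv a t -> exists2 T, co_itv a T &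
  \forall h \near 0^'+, 0 < h /\ t + h <= T.
Proof.
move=> /co_itv_right[T aT tT]; exists T => //; near=> h; split.
  by near: h; exact: nbhs_right_gt.
suff : h < T - t by lra.
by near: h; apply: nbhs_right_lt; lra.
Unshelve. all: end_near.
Qed.

(** * Monotonicity from almost everywhere derivatives *)

(** The exceptional null set is covered by an open set [U] on which the
    integral of [|m|] is small. Outside [U] the derivative controls the growth
    of [F] to the right of each point, and inside [U] the integral does; the
    set of endpoints up to which the two controls add up is closed under limits
    from the left and can always be extended to the right, so it reaches [t]. *)
Lemma upper_ac_le_integrable (R : realType) (F m : R -> R) (s t : R) (N : set R) :
  s <= t ->
  lebesgue_measure.-integrable setT (EFin \o m) ->
  (forall x y, s <= x -> x <= y -> y <= t ->
     F y - F x <= \int[lebesgue_measure]_(r in `[x, y]) `|m r|) ->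
  lebesgue_measure.-negligible N ->
  (forall x, s <= x < t -> ~ N x -> forall e, 0 < e ->
     \forall h \near 0^'+, F (x + h) <= F x + e * h) ->
  F t <= F s.
Proof.
move=> st im Fm [N' [mN' N'0 NN']] Fd.
pose nu (A : set R) := \int[lebesgue_measure]_(r in A) `|m r|.
have imA A : measurable A -> lebesgue_measure.-integrable A (EFin \o (fun r => `|m r|)).
  move=> mA; have := integrable_norm im.
  exact: integrableS.
have nuS (A B : set R) : measurable A -> measurable B -> A `<=` B -> nu A <= nu B.
  move=> mA mB AB; rewrite /nu.
  rewrite (_ : B = A `|` (B `\` A)); last first.
    by rewrite setDUK.
  have mD : measurable (B `\` A) by exact: measurableD.
  rewrite Rintegral_setU//; first last.
  - by apply/disj_set2P; rewrite setDIK.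
  - by apply: imA; apply: measurableU.
  by rewrite lerDl Rintegral_ge0.
have nuU (A B : set R) : measurable A -> measurable B -> A `&` B = set0 ->
    nu (A `|` B) = nu A + nu B.
  move=> mA mB AB; rewrite /nu Rintegral_setU//.
    by apply: imA; apply: measurableU.
  by apply/disj_set2P.
have nuco (x y : R) : nu `[x, y]%classic = nu `[x, y[%classic.
  by rewrite /nu Rintegral_itv_bndo_bndc//; apply: imA.
apply/ler_addgt0Pr => e e0.
have [d [d0 dP]] := integral_normr_continuous im (e := e / 2) ltac:(by rewrite divr_gt0).
have [|U [oU NU Ud]] := @lebesgue_regularity_outer R N' d mN' _ d0.
  by rewrite [X in (X < _)%E]N'0.
have {}Ud : (lebesgue_measure U < d%:E)%E.
  have mU := measurable_realfun.open_measurable oU.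
  rewrite -(setDUK NU) measureU//; first last.
  - by rewrite setDIK.
  - exact: measurableD.
  by rewrite [X in (X + _)%E](_ : _ = 0%E)// add0e.
have mU : measurable U by exact: measurable_realfun.open_measurable.
have nuU2 : nu U < e / 2 by exact: dP.
pose e' := e / 2 / (t - s + 1).
have e'0 : 0 < e' by rewrite !divr_gt0//; lra.
pose good z := F z <= F s + e' * (z - s) + nu (U `&` `[s, z[%classic).
have mUs z : measurable (U `&` `[s, z[%classic) by exact: measurableI.
pose Z := [set z | s <= z <= t /\ good z].
have Zs : Z s.
  split; first by rewrite lexx.
  by rewrite /good subrr mulr0 addr0 lerDl Rintegral_ge0.
have supZ : has_sup Z.
  by split; [exists s | exists t => z [] /andP[]].
pose c := sup Z.
have sc : s <= c by exact: sup_upper_bound.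
have ct : c <= t by apply: ge_sup; [exists s | move=> z [] /andP[]].
have Zc : Z c.
  split; first by rewrite sc ct.
  rewrite /good; apply/ler_addgt0Pr => e1 e10.
  have [d1 [d10 d1P]] := integral_normr_continuous im e10.
  have [z [/andP[sz zt] gz] cz] := sup_adherent d10 supZ.
  have zc : z <= c by apply: sup_upper_bound => //; split => //; apply/andP.
  have nuz : nu `[z, c]%classic < e1.
    have cz' : c - z < d1 by move: cz; rewrite -/c; lra.
    suff : (lebesgue_measure (`[z, c]%classic : set R) < d1%:E)%E by exact: d1P.
    by rewrite lebesgue_measure_itv/=; case: ifPn => _; rewrite lte_fin.
  have := Fm z c sz zc ct; rewrite -/(nu _) => Fzc.
  have : nu (U `&` `[s, z[%classic) <= nu (U `&` `[s, c[%classic).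
    by apply: nuS => //; apply: setIS => x /=; rewrite !in_itv/= => /andP[-> /lt_le_trans ->].
  have : e' * (z - s) <= e' * (c - s) by rewrite ler_pM2l// lerD2r.
  by move: gz; rewrite /good; lra.
have [cltt|tlec] := ltP c t; last first.
  have ct' : c = t by apply/le_anti/andP.
  case: Zc => _; rewrite /good ct'.
  have : nu (U `&` `[s, t[%classic) <= nu U by apply: nuS.
  have : e' * (t - s) <= e / 2.
    rewrite /e' -mulrA ler_piMr//; first by lra.
    by rewrite mulrC ler_pdivrMr; lra.
  lra.
exfalso.
have ext : exists2 y, c < y <= t & good y.
  case: Zc => _ gc.
  have [Uc|Uc] := pselect (U c).
    have [d1 /= d10 d1P] : nbhs c U by exact: open_nbhs_nbhs.
    pose y := Num.min t (c + d1 / 2).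
    have cy : c < y by rewrite lt_min cltt/=; lra.
    have yt : y <= t by rewrite ge_min lexx.
    have yd : y <= c + d1 / 2 by rewrite ge_min lexx orbT.
    exists y; first by rewrite cy yt.
    have := Fm c y sc (ltW cy) yt; rewrite -/(nu _) nuco => Fcy.
    have : nu (U `&` `[s, c[%classic) + nu `[c, y[%classic <= nu (U `&` `[s, y[%classic).
      rewrite -nuU//; last first.
        apply/seteqP; split => // x [[_]]/=; rewrite !in_itv/=.
        by move=> /andP[_ xc] /andP[cx _]; move: xc; rewrite ltNge cx.
      apply: nuS => //; first exact: measurableU.
      move=> x [[Ux]|] /=; rewrite !in_itv/= => /andP[x1 x2].
        by split => //; rewrite x1 (lt_trans x2).
      split; last by rewrite (le_trans sc).
      apply: d1P; rewrite /ball/= ltr_norml; lra.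
    have : e' * (c - s) <= e' * (y - s) by rewrite ler_pM2l// lerD2r ltW.
    by move: gc; rewrite /good; lra.
  have [||d1 /= d10 d1P] := Fd c _ _ e' e'0.
  - by rewrite sc cltt.
  - by move=> Nc; apply/Uc/NU/NN'.
  pose h := Num.min (t - c) (d1 / 2).
  have h0 : 0 < h by rewrite lt_min subr_gt0 cltt/= divr_gt0.
  have ht : h <= t - c by rewrite ge_min lexx.
  have hd : h <= d1 / 2 by rewrite ge_min lexx orbT.
  exists (c + h); first by apply/andP; split; lra.
  have := d1P h; rewrite /= sub0r normrN gtr0_norm// => /(_ ltac:(lra) h0).
  have : nu (U `&` `[s, c[%classic) <= nu (U `&` `[s, (c + h)[%classic).
    apply: nuS => //; apply: setIS => x /=; rewrite !in_itv/= => /andP[-> xc]/=; lra.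
  by move: gc; rewrite /good; lra.
have [y /andP[cy yt] gy] := ext.
have : y <= c by apply: sup_upper_bound => //; split => //; rewrite yt andbT; lra.
lra.
Qed.

(** Only an upper bound on increments is assumed, so that [F] may jump
    downwards: the lemma applies to sums of absolutely continuous and
    nonincreasing functions. *)
Lemma upper_ac_le (R : realType) (F m : R -> R) (s t : R) (N : set R) :
  s <= t ->
  lebesgue_measure.-integrable `[s, t] (EFin \o m) ->
  (forall x y, s <= x -> x <= y -> y <= t ->
     F y - F x <= \int[lebesgue_measure]_(r in `[x, y]) m r) ->
  lebesgue_measure.-negligible N ->
  (forall x, s < x < t -> ~ N x -> forall e, 0 < e ->
     \forall h \near 0^'+, F (x + h) <= F x + e * h) ->
  F t <= F s.
Proof.
move=> st im Fm N0 Fd.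
have im' : lebesgue_measure.-integrable setT (EFin \o (m \_ `[s, t])).
  by rewrite -restrict_EFin; apply/(integrable_mkcond _ _).1.
have Ns0 : lebesgue_measure.-negligible (N `|` [set s]).
  apply: negligibleU => //; exists [set s]; split => //.
  exact: lebesgue_measure_set1.
apply: (upper_ac_le_integrable st im' _ Ns0) => [x y sx xy yt|x /andP[sx xt] Nx].
  apply: (le_trans (Fm _ _ sx xy yt)).
  have imxy : lebesgue_measure.-integrable `[x, y] (EFin \o m).
    apply: integrableS im => // z /=; rewrite !in_itv/= => /andP[xz zy].
    by rewrite (le_trans sx) ?(le_trans zy).
  apply: (le_trans (ler_norm _)).
  apply: (le_trans (le_normr_Rintegral _ _)) => //.
  rewrite le_eqVlt; apply/orP; left; apply/eqP.
  apply: eq_Rintegral => z; rewrite inE/= in_itv/= => /andP[xz zy].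
  rewrite patchE mem_set//= in_itv/=.
  by rewrite (le_trans sx) ?(le_trans zy).
apply: Fd.
  rewrite xt andbT lt_neqAle sx andbT; apply/eqP => sx'; apply: Nx; right.
  by rewrite /= sx'.
by move=> ?; apply: Nx; left.
Qed.

Lemma upper_lipschitz_le (R : realType) (F : R -> R) (L s t : R) (N : set R) :
  s <= t ->
  (forall x y, s <= x -> x <= y -> y <= t -> F y - F x <= L * (y - x)) ->
  lebesgue_measure.-negligible N ->
  (forall x, s < x < t -> ~ N x -> forall e, 0 < e ->
     \forall h \near 0^'+, F (x + h) <= F x + e * h) ->
  F t <= F s.
Proof.
move=> st FL; apply: (@upper_ac_le _ _ (cst L)) => //.
  apply: continuous_compact_integrable; first exact: segment_compact.
  by apply: continuous_subspaceT => x; exact: cst_continuous.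
move=> x y sx xy yt; apply: le_trans (FL _ _ sx xy yt) _.
rewrite Rintegral_cst//= lebesgue_measure_itv/= lte_fin.
case: ltP => [xy'|yx] /=; first by rewrite lexx.
by rewrite (_ : y = x) ?subrr//; apply/le_anti/andP.
Qed.

(** * The local slope of a convex functional *)

Section slope.
Context {R : realType} {S : metricType R}.
Variable f : S -> \bar R.
Hypothesis fNy : forall v, (-oo < f v)%E.

Lemma slope_ge0 v : (0 <= local_slope f v)%E.
Proof. by rewrite /local_slope; case: ifPn => // _; rewrite le_max lexx. Qed.

Lemma dom_of_slope v : edom (local_slope f) v -> (f v < +oo)%E.
Proof. by rewrite /edom /= /local_slope; case: ifPn. Qed.

(** Together with [slope_le_near], this translates the limit superior into
    inequalities between real numbers, free of quotients. *)
Lemma slope_lt_near (v : S) (x g' : R) : f v = x%:E -> (local_slope f v < g'%:E)%E ->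
  exists2 d : R, 0 < d & forall w z, mdist v w < d -> f w = z%:E ->
    x - z <= g' * mdist v w.
Proof.
move=> fv; rewrite /local_slope fv ltry gt_max => /andP[g0].
move=> /ereal_inf_lt[_ [V vV <-]] supV.
have [d /= d0 dV] := (metricType_numDomainType.nbhs_mdistP v _).1 vV.
exists d => // w z vw fw.
have [wv|wv] := eqVneq w v.
  by move: fw; rewrite wv fv => -[->]; rewrite subrr mdistxx mulr0.
have vw0 : 0 < mdist v w by rewrite mdist_gt0 eq_sym.
have : (maxe (f v - f w) 0 * ((mdist v w)^-1)%:E <= g'%:E)%E.
  apply: le_trans (ltW supV); apply: ereal_sup_ubound => /=.
  by exists w => //=; [exact: dV | rewrite -fv].
rewrite fv fw -EFinB -EFin_max -EFinM lee_fin.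
rewrite ler_pdivrMr// => /(le_trans _) -> //.
by rewrite le_max lexx.
Qed.

(** Competitors of infinite energy contribute 0 to the difference quotient and
    impose no condition. *)
Lemma slope_le_near (v : S) (x g : R) : f v = x%:E -> 0 <= g ->
  (forall g', g < g' -> exists2 d : R, 0 < d & forall w z, w != v ->
     mdist v w < d -> f w = z%:E -> x - z <= g' * mdist v w) ->
  (local_slope f v <= g%:E)%E.
Proof.
move=> fv g0 H; rewrite /local_slope fv ltry ge_max lee_fin g0/=.
apply/lee_addgt0Pr => e e0.
have [|d d0 dH] := H (g + e); first by rewrite ltrDl.
apply: (@le_trans _ _ (ereal_sup [set (maxe (x%:E - f w) 0 * ((mdist v w)^-1)%:E)%E | w in
   [set w | w != v /\ mdist v w < d]])).
  apply: ereal_inf_lbound; exists [set w | w != v /\ mdist v w < d] => //.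
  by apply/(metricType_numDomainType.nbhs_mdistP v _); exists d.
apply/ereal_supP => _ [w [wv wd] <-] /=.
have vw0 : 0 < mdist v w by rewrite mdist_gt0 eq_sym.
case: (f w) (fNy w) (dH w) => [z _|_ _|//]; last first.
  have ge0 : 0 <= g + e by rewrite addr_ge0// ltW.
  by rewrite /= maxNye mul0e -EFinD lee_fin.
move=> /(_ z wv wd erefl) xz.
rewrite -EFinB -EFin_max -EFinM -EFinD lee_fin ler_pdivrMr// ge_max xz/=.
by rewrite mulr_ge0 ?addr_ge0// ltW.
Qed.

(** Along the curve from [v] to [w], the energy drops by at least
    [t (f v - f w + lam (1 - psi t) d^p0)] while the distance from [v] is at most
    [t d]; comparing the quotient with the slope as [t] tends to 0 removes
    [psi]. *)
Lemma slope_global (p0 lam : R) (v w : S) (x y g : R) :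
  0 < p0 -> plambda_convex p0 lam f ->
  f v = x%:E -> (f w <= y%:E)%E -> (local_slope f v <= g%:E)%E ->
  x - y <= g * mdist v w - lam * mdist v w `^ p0.
Proof.
move=> p00 [psi [psi01 psi0 _ cvx]] fv fw gv.
have [vw|vw] := eqVneq v w.
  move: fw; rewrite -vw fv lee_fin => xy.
  by rewrite mdistxx powR0 ?gt_eqF// !mulr0 subr0 subr_le0.
have D0 : 0 < mdist v w by rewrite mdist_gt0.
set D := mdist v w in D0 *.
rewrite leNgt; apply/negP => lt1.
pose c := (x - y + lam * D `^ p0) / D.
have gc : g < c by rewrite /c ltr_pdivlMr// -ltrBlDr.
pose g' := (g + c) / 2.
have gg' : g < g' by rewrite /g'; lra.
have g'c : g' < c by rewrite /g'; lra.
have g0 : 0 <= g by rewrite -lee_fin (le_trans (slope_ge0 v)).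
have [|d d0 dP] := slope_lt_near fv (g' := g'); first by rewrite (le_lt_trans gv)// lte_fin.
have [gam [_ gam0 gam1 H]] := cvx v w.
pose L (t : R) := x - y + lam * (1 - psi t) * D `^ p0.
have Lcvg : L t @[t --> 0^'+] --> c * D.
  rewrite (_ : c * D = x - y + lam * (1 - 0) * D `^ p0).
    apply: cvgD; first exact: cvg_cst.
    apply: cvgM; last exact: cvg_cst.
    apply: cvgM; first exact: cvg_cst.
    by apply: cvgB => //; exact: cvg_cst.
  by rewrite /c divfK ?gt_eqF// subr0 mulr1.
have : \forall t \near 0^'+, g' * D < L t.
  by apply: (cvgr_gt _ Lcvg); rewrite ltr_pM2r.
move=> Lnear.
have : \forall t \near (0:R)^'+, 0 < t /\ (t < 1 /\ (t * D < d /\ g' * D < L t)).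
  near=> t; split; first by near: t; exact: nbhs_right_gt.
  split; first by near: t; exact: nbhs_right_lt.
  split; last by near: t.
  rewrite -ltr_pdivlMr//; near: t; apply: nbhs_right_lt; exact: divr_gt0.
move=> /filter_ex[t [t0 [t1 [td tL]]]].
have [|dg fg] := H t; first by rewrite !ltW.
rewrite gam0 gam1 metric_sym (metric_sym w) -/D in dg.
rewrite gam0 gam1 -/D fv in fg.
have fg' : (f (gam t) <= (x - t * L t)%:E)%E.
  apply: (le_trans fg).
  apply: (@le_trans _ _ (((1 - t) * x)%:E + (t * y)%:E - (lam * t * (1 - psi t) * D `^ p0)%:E)%E).
    rewrite leeB// leeD// EFinM lee_pmul2l// ?lte_fin//.
  by rewrite -!EFinD lee_fin /L; lra.
move: fg'; case E : (f (gam t)) (fNy (gam t)) => [z|//|//] _; rewrite lee_fin => zL.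
have := dP (gam t) z (le_lt_trans dg td) E.
have : t * (g' * D) < t * L t by rewrite ltr_pM2l.
have : g' * mdist v (gam t) <= g' * (t * D).
  by rewrite ler_wpM2l// (le_trans g0)// ltW.
lra.
Unshelve. all: end_near.
Qed.

Lemma slope_global_upper (p0 lam : R) (v w : S) (x y g : R) :
  0 < p0 -> plambda_convex p0 lam f ->
  f v = x%:E -> (f w <= y%:E)%E -> (local_slope f v <= g%:E)%E ->
  x - y <= g * mdist v w + Num.max 0 (- lam) * mdist v w `^ p0.
Proof.
move=> p00 cvx fv fw gv; apply: le_trans (slope_global p00 cvx fv fw gv) _.
by rewrite lerD2l -mulNr ler_wpM2r ?powR_ge0// le_max lexx orbT.
Qed.

(** The global inequality passes to the limit along points [y] converging to
    [v] with slope at most [a], since [f] is lower semicontinuous; it then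
    bounds the slope at [v] because [p0 > 1] makes the error term negligible.
    The factor 2 in the error term spares any continuity of powers. *)
Lemma local_slope_lsc (p0 lam : R) : 1 < p0 -> plambda_convex p0 lam f ->
  lower_semicontinuous f -> lower_semicontinuous (local_slope f).
Proof.
move=> p01 cvx flsc v a av.
have p00 : 0 < p0 by rewrite (lt_trans _ p01).
have [a0|a0] := ltP a 0.
  exists setT; first exact: filterT.
  by move=> y _; rewrite (lt_le_trans _ (slope_ge0 y))// lte_fin.
apply: contrapT => H.
have {}H V : nbhs v V -> exists2 y, V y & (local_slope f y <= a%:E)%E.
  move=> nV; apply: contrapT => H2; apply: H; exists V; first exact: nV.
  move=> y Vy; rewrite ltNge; apply/negP => le; apply: H2; exists y => //.
set k := Num.max 0 (- lam).
have k0 : 0 <= k by rewrite le_max lexx.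
(* A point [y] with [d(v,y) < e d(v,w)] satisfies [d(y,w) <= (1 + e) d(v,w)], and
   [e] is sent to 0 below. *)
have key (w : S) (z x e : R) : w != v -> f w = z%:E -> (x%:E < f v)%E -> 0 < e -> e <= 1 ->
    x - z <= a * ((1 + e) * mdist v w) + k * (2 * mdist v w) `^ p0.
  move=> wv fw xv e0 e1.
  have [V nV VP] := flsc _ _ xv.
  have vw0 : 0 < mdist v w by rewrite mdist_gt0 eq_sym.
  have [|y [Vy yv] sy] := H (V `&` [set y | mdist v y < e * mdist v w]).
    apply: filterI => //.
    apply/(metricType_numDomainType.nbhs_mdistP v _); exists (e * mdist v w) => //=.
    exact: mulr_gt0.
  have fy : (f y < +oo)%E by apply: dom_of_slope; rewrite /edom/= (le_lt_trans sy)// ltry.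
  case E : (f y) (fNy y) fy (VP y Vy) => [x'|//|//] _ _; rewrite lte_fin => xx'.
  have := slope_global_upper p00 cvx E (y := z) (w := w) _ sy.
  rewrite fw lexx -/k => /(_ isT) h.
  have dyw : mdist y w <= (1 + e) * mdist v w.
    by apply: (le_trans (metric_triangle _ v _)); rewrite metric_sym /= in yv *; lra.
  have : a * mdist y w <= a * ((1 + e) * mdist v w) by rewrite ler_wpM2l.
  have : k * mdist y w `^ p0 <= k * (2 * mdist v w) `^ p0.
    have eD : e * mdist v w <= mdist v w by rewrite ler_piMl// ltW.
    apply: ler_wpM2l => //; apply: ge0_ler_powR; rewrite ?nnegrE ?mdist_ge0 ?(ltW p00)//; lra.
  lra.
have fvoo : (f v < +oo)%E.
  rewrite ltey; apply/eqP => fvoo.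
  have [y _ sy] := H setT filterT.
  have fy : (f y < +oo)%E by apply: dom_of_slope; rewrite /edom/= (le_lt_trans sy)// ltry.
  case E : (f y) (fNy y) fy => [z|//|//] _ _.
  have yv : y != v by apply/eqP => yv; move: E; rewrite yv fvoo.
  have := key y z (z + (a * ((1 + 1) * mdist v y) + k * (2 * mdist v y) `^ p0) + 1) 1 yv E.
  by rewrite fvoo ltry ltr01 lexx => /(_ isT isT isT); lra.
case E : (f v) (fNy v) fvoo key => [xv|//|//] _ _ key.
suff : (local_slope f v <= a%:E)%E by rewrite leNgt av.
apply: (slope_le_near E a0) => g' ag'.
have [d d0 dP] : exists2 d : R, 0 < d &
    forall h, 0 <= h -> h < d -> h `^ (p0 - 1) < (g' - a) / (k * 2 `^ p0 + 1).
  by apply: powR_small; rewrite ?subr_gt0// divr_gt0 ?subr_gt0// ltr_wpDl// mulr_ge0// powR_ge0.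
exists d => // w z wv wd fw.
have vw0 : 0 < mdist v w by rewrite mdist_gt0 eq_sym.
have : xv - z <= a * mdist v w + k * (2 * mdist v w) `^ p0.
  apply/ler_addgt0Pr => e e0.
  have ad0 : 0 <= a * mdist v w by rewrite mulr_ge0// ltW.
  pose e' := Num.min 1 (e / 2 / (a * mdist v w + 1)).
  have e'0 : 0 < e' by rewrite lt_min ltr01 !divr_gt0// ltr_wpDl.
  have e'1 : e' <= 1 by rewrite ge_min lexx.
  have : e' * (a * mdist v w + 1) <= e / 2.
    by rewrite -ler_pdivlMr ?ltr_wpDl// ge_min lexx orbT.
  have := key w z (xv - e / 2) e' wv fw _ e'0 e'1.
  by rewrite lte_fin => /(_ ltac:(lra)); lra.
have -> : (2 * mdist v w) `^ p0 = 2 `^ p0 * (mdist v w * mdist v w `^ (p0 - 1)).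
  by rewrite powRM ?mdist_ge0// mulr_powRB1// mdist_ge0.
have := dP _ (ltW vw0) wd.
have K0 : 0 <= k * 2 `^ p0 by rewrite mulr_ge0// powR_ge0.
set hh := mdist v w `^ (p0 - 1); have hh0 : 0 <= hh by exact: powR_ge0.
have K1 : 0 < k * 2 `^ p0 + 1 by lra.
rewrite ltr_pdivlMr// => hhlt.
have Kh : k * 2 `^ p0 * hh <= g' - a by lra.
have : (k * 2 `^ p0 * hh) * mdist v w <= (g' - a) * mdist v w.
  by apply: ler_wpM2r => //; exact: ltW.
lra.
Qed.

End slope.

(** * Energy dissipation and length along a curve *)

Section energy_curve.
Context {R : realType} {S : metricType R}.
Variables (u : R -> S) (E : R -> R) (G : R -> \bar R) (a : \bar R) (p q : R).
Local Notation Gq t := (G t `^ q)%E.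

(** The one-sided first order expansion that holds at almost every time: [eta]
    is the common value of [- E'], [G^q] and [|u'|^p], and [l] is [|u'|]. *)
Definition regular_point x := exists eta l : R,
  [/\ Gq x = eta%:E, 0 <= l, l `^ p <= eta,
      forall e, 0 < e -> \forall h \near 0^'+, E (x + h) <= E x - (eta - e) * h &
      forall e, 0 < e -> \forall h \near 0^'+, mdist (u x) (u (x + h)) <= (l + e) * h].

(** What survives of the definition of a curve of maximal slope once the energy
    and the slope are regarded as functions of time. *)
Record energy_curve : Prop := EnergyCurve {
  energy_ac : AC_loc a u;
  energy_dec : forall s t, co_itv a s -> co_itv a t -> s <= t -> E t <= E s;
  energy_regular :
    lebesgue_measure.-negligible [set x | co_itv a x /\ ~ regular_point x] }.

Hypotheses (p1 : 1 < p) (pq : p^-1 + q^-1 = 1).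
Hypothesis ec : energy_curve.
Let u_ac := energy_ac ec.
Let E_dec := energy_dec ec.
Let ae_regular := energy_regular ec.

(** [E + c x] has nonpositive derivative almost everywhere and Lipschitz upper
    increments, because [E] is nonincreasing. *)
Lemma energy_drop_ge s t c : co_itv a t -> 0 <= s -> s <= t ->
  (forall x, s < x < t -> (c%:E <= Gq x)%E) -> c * (t - s) <= E s - E t.
Proof.
move=> at_ s0 st cH.
suff : E t + c * t <= E s + c * s by lra.
apply: (@upper_lipschitz_le _ (fun x => E x + c * x) c s t _ st _ ae_regular).
  move=> x y sx xy yt.
  have ay : co_itv a y by apply: co_itv_le at_ _ yt; lra.
  have ax : co_itv a x by apply: co_itv_le ay _ xy; lra.
  by have := E_dec ax ay xy; lra.
move=> x /andP[sx xt] Nx e e0.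
have ax : co_itv a x by apply: co_itv_le at_ _ _; lra.
have [eta [l [Hx l0 leta Ex _]]] : regular_point x.
  by apply: contrapT => nr; apply: Nx.
have := cH x; rewrite sx xt Hx lee_fin => /(_ isT) ceta.
near=> h.
have h0 : 0 < h by near: h; exact: nbhs_right_gt.
have : E (x + h) <= E x - (eta - e) * h by near: h; exact: Ex.
have : c * h <= eta * h by rewrite ler_pM2r.
lra.
Unshelve. all: end_near.
Qed.

(** An integrated form of [y |u'| <= |u'|^p / p + y^q / q <= - E' / p + y^q / q];
    the comparison is applied to [y d(u s, .) + E / p - (y^q / q) x]. *)
Lemma dist_young s t y : co_itv a t -> 0 <= s -> s <= t -> 0 < y ->
  y * mdist (u s) (u t) <= (E s - E t) / p + (t - s) * y `^ q / q.
Proof.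
move=> at_ s0 st y0.
have p0 := exponent_gt0 p1; have q0 := conj_exponent_gt0 p1 pq.
have [m [im um]] := u_ac.
have as_ : co_itv a s by apply: co_itv_le at_ _ _.
have stco : `[s, t]%classic `<=` co_itv a.
  by move=> x /=; rewrite in_itv/= => /andP[sx xt]; apply: co_itv_le at_ _ xt; lra.
have imst := im _ (@segment_compact _ s t) stco.
suff : y * mdist (u s) (u t) + E t / p - y `^ q / q * t <=
       y * mdist (u s) (u s) + E s / p - y `^ q / q * s by rewrite mdistxx; lra.
have yq0 : 0 <= y `^ q / q by rewrite divr_ge0 ?powR_ge0// ltW.
apply: (@upper_ac_le _ (fun x => y * mdist (u s) (u x) + E x / p - y `^ q / q * x)
  (fun x => y * m x) s t _ st _ _ ae_regular).
- rewrite [X in integrable _ _ X](_ : _ = (fun x => y%:E * (EFin \o m) x)%E)//.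
  exact: integrableZl.
- move=> x z sx xz zt.
  have az : co_itv a z by apply: co_itv_le at_ _ zt; lra.
  have ax : co_itv a x by apply: co_itv_le az _ xz; lra.
  rewrite RintegralZl//; last first.
    apply: integrableS imst => // w /=; rewrite !in_itv/= => /andP[xw wz].
    by rewrite (le_trans sx)//= (le_trans wz).
  have : y * mdist (u x) (u z) <= y * \int[lebesgue_measure]_(r in `[x, z]) m r.
    by rewrite ler_pM2l// um.
  have : y * mdist (u s) (u z) <= y * (mdist (u s) (u x) + mdist (u x) (u z)).
    by rewrite ler_pM2l// metric_triangle.
  have : E z / p <= E x / p by rewrite ler_pM2r ?invr_gt0// E_dec.
  have : y `^ q / q * x <= y `^ q / q * z by rewrite ler_wpM2l.
  lra.
move=> x /andP[sx xt] Nx e e0.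
have ax : co_itv a x by apply: co_itv_le at_ _ _; lra.
have [eta [l [Hx l0 leta Ex ux]]] : regular_point x.
  by apply: contrapT => nr; apply: Nx.
have e1 : 0 < e / 2 / y by rewrite !divr_gt0.
have e2 : 0 < e / 2 by rewrite !divr_gt0.
have yl : y * l <= eta / p + y `^ q / q.
  have := conjugate_powR l0 (ltW y0) p0 q0 pq.
  have : l `^ p / p <= eta / p by rewrite ler_pM2r ?invr_gt0.
  lra.
near=> h.
have h0 : 0 < h by near: h; exact: nbhs_right_gt.
have Eh : E (x + h) <= E x - (eta - e / 2) * h by near: h; exact: Ex.
have uh : mdist (u x) (u (x + h)) <= (l + e / 2 / y) * h by near: h; exact: ux.
have : E (x + h) / p <= (E x - (eta - e / 2) * h) / p by rewrite ler_pM2r ?invr_gt0.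
have : y * mdist (u s) (u (x + h)) <= y * (mdist (u s) (u x) + (l + e / 2 / y) * h).
  by rewrite ler_pM2l// (le_trans (metric_triangle _ (u x) _))// lerD2l.
have -> : y * (mdist (u s) (u x) + (l + e / 2 / y) * h) =
    y * mdist (u s) (u x) + y * l * h + e / 2 * h.
  by field; rewrite gt_eqF.
have : y * l * h <= (eta / p + y `^ q / q) * h by rewrite ler_pM2r.
have : e / 2 * h / p <= e / 2 * h.
  by rewrite ler_pdivrMr// ler_peMr ?mulr_ge0 ?ltW.
have -> : (E x - (eta - e / 2) * h) / p = E x / p - eta / p * h + e / 2 * h / p.
  by field; rewrite gt_eqF.
lra.
Unshelve. all: end_near.
Qed.

(** Optimizing [dist_young] over [y]: the choice [y^q = (E s - E t) / (t - s)]
    reproduces the bound that Hoelder's inequality gives for the length. *)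
Lemma dist_powR_le s t : co_itv a t -> 0 <= s -> s < t ->
  mdist (u s) (u t) `^ p <= (E s - E t) * (t - s) `^ (p - 1).
Proof.
move=> at_ s0 st.
have p0 := exponent_gt0 p1; have q0 := conj_exponent_gt0 p1 pq; have q1 := conj_exponent_gt1 p1 pq.
have as_ : co_itv a s by apply: co_itv_le at_ _ _; rewrite // ltW.
have D0 : 0 <= E s - E t by rewrite subr_ge0 E_dec// ltW.
have h0 : 0 < t - s by rewrite subr_gt0.
have Y := dist_young at_ s0 (ltW st).
move: D0; rewrite le_eqVlt => /predU1P[D0|D0].
  rewrite -D0 mul0r.
  suff -> : mdist (u s) (u t) = 0 by rewrite powR0// gt_eqF.
  apply/eqP; rewrite eq_le mdist_ge0 andbT leNgt; apply/negP => d0.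
  have q10 : 0 < q - 1 by lra.
  have [|r r0 rP] := @powR_small _ (q - 1) (mdist (u s) (u t) * q / (t - s)) q10.
    by rewrite divr_gt0// mulr_gt0.
  have r20 : 0 < r / 2 by rewrite divr_gt0.
  have := rP (r / 2) (ltW r20) ltac:(lra).
  rewrite ltr_pdivlMr// => lt1.
  have := Y _ r20; rewrite -D0 mul0r add0r.
  rewrite -(mulr_powRB1 (ltW r20) q0) [X in _ <= X / q]mulrCA -[X in _ <= X]mulrA.
  by rewrite ler_pM2l// ler_pdivlMr// leNgt [ltLHS]mulrC lt1.
set D := E s - E t in D0 Y *; set h := t - s in h0 Y *.
pose y := (D / h) `^ q^-1.
have Dh0 : 0 < D / h by rewrite divr_gt0.
have y0 : 0 < y by rewrite powR_gt0.
have yq : y `^ q = D / h by rewrite /y -powRrM mulVf ?gt_eqF// powRr1// ltW.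
have yp : y `^ p = (D / h) `^ (p - 1).
  rewrite /y -powRrM; congr (_ `^ _).
  by rewrite -{1}(conj_exponentE p1 pq) mulrCA mulVf ?gt_eqF// mulr1.
have yd : y * mdist (u s) (u t) <= D.
  apply: (le_trans (Y y y0)); rewrite yq.
  have -> : h * (D / h) / q = D / q by field; rewrite !gt_eqF.
  by rewrite -mulrDr pq mulr1.
have : (y * mdist (u s) (u t)) `^ p <= D `^ p.
  by apply: ge0_ler_powR; rewrite ?nnegrE ?mulr_ge0 ?mdist_ge0 ?(ltW p0) ?(ltW y0) ?(ltW D0).
rewrite powRM ?mdist_ge0 ?(ltW y0)// yp -(mulr_powRB1 (ltW D0) p0).
have -> : (D / h) `^ (p - 1) = D `^ (p - 1) / h `^ (p - 1).
  have -> : D `^ (p - 1) = (D / h * h) `^ (p - 1) by rewrite divfK// gt_eqF.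
  by rewrite [X in _ = X / _]powRM ?(ltW Dh0) ?(ltW h0)// mulfK// gt_eqF// powR_gt0.
have P1 : 0 < D `^ (p - 1) by rewrite powR_gt0.
have P2 : 0 < h `^ (p - 1) by rewrite powR_gt0.
rewrite -mulrA mulrC [leRHS]mulrC -[leLHS]mulrC ler_pM2l//.
by rewrite mulrC ler_pdivrMr.
Qed.

Lemma curve_continuous x e : co_itv a x -> 0 < e ->
  exists2 d : R, 0 < d & forall y, co_itv a y -> `|y - x| < d -> mdist (u x) (u y) < e.
Proof.
move=> ax e0; have pp := exponent_gt0 p1; have p10 : 0 < p - 1 by rewrite subr_gt0.
have [T aT xT] := co_itv_right ax.
have a0 : co_itv a 0 := co_itv_le ax (lexx 0) ax.1.
pose M := E 0 - E T + 1.
have M0 : 0 < M.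
  by have := E_dec a0 aT aT.1; rewrite /M; lra.
have [|d d0 dP] := @powR_small _ (p - 1) (e `^ p / M) p10; first by rewrite divr_gt0// powR_gt0.
have key s t : 0 <= s -> s < t -> t <= T -> t - s < d -> mdist (u s) (u t) < e.
  move=> s0 st tT std.
  have at_ : co_itv a t by apply: co_itv_le aT _ _ => //; lra.
  have as_ : co_itv a s by apply: co_itv_le at_ _ _ => //; lra.
  have B := dist_powR_le at_ s0 st.
  have DM : E s - E t <= M.
    have := E_dec a0 as_ s0; have := E_dec at_ aT tT; rewrite /M; lra.
  have := dP (t - s) ltac:(lra) std; rewrite ltr_pdivlMr// mulrC => hM.
  rewrite ltNge; apply/negP => ed.
  have : e `^ p <= mdist (u s) (u t) `^ p.
    by apply: ge0_ler_powR; rewrite ?nnegrE ?mdist_ge0 ?(ltW pp) ?(ltW e0).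
  rewrite leNgt (le_lt_trans B)//; apply: le_lt_trans hM.
  by rewrite ler_wpM2r// powR_ge0.
exists (Num.min d (T - x)); first by rewrite lt_min d0 subr_gt0.
move=> y ay; rewrite lt_min => /andP[yd yT].
have [xy|xy|<-] := ltgtP x y.
- by apply: key; rewrite ?ax.1//; move: yd yT; rewrite gtr0_norm ?subr_gt0//; lra.
- rewrite metric_sym; apply: key; rewrite ?ay.1//; move: yd yT;
    rewrite ltr0_norm ?subr_lt0//; lra.
by rewrite mdistxx.
Qed.

End energy_curve.

(** * Growth of the slope along a curve *)

Section slope_curve.
Context {R : realType} {S : metricType R}.
Variables (u : R -> S) (E : R -> R) (G : R -> \bar R) (a : \bar R) (p q kap p0 : R).
Local Notation Gq t := (G t `^ q)%E.

(** An energy curve whose drop of energy is also controlled from above by the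
    slope at the initial time, up to an error that is absent ([kap = 0]) in the
    convex case. *)
Record slope_curve : Prop := SlopeCurve {
  slope_curve_energy : energy_curve u E G a p q;
  slope_curve_kap_ge0 : 0 <= kap;
  slope_curve_kap : kap = 0 \/ p <= p0;
  slope_curve_ge0 : forall t, (0 <= G t)%E;
  slope_curve_drop : forall s t g, co_itv a s -> co_itv a t -> G s = g%:E ->
    E s - E t <= g * mdist (u s) (u t) + kap * mdist (u s) (u t) `^ p0;
  slope_curve_lsc : forall x c, co_itv a x -> (c%:E < Gq x)%E ->
    exists2 d : R, 0 < d & forall y, co_itv a y -> `|y - x| < d -> (c%:E < Gq y)%E }.

Hypotheses (p1 : 1 < p) (pq : p^-1 + q^-1 = 1).
Hypothesis slc : slope_curve.
Let enc := slope_curve_energy slc.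
Let E_dec := energy_dec enc.
Let kap_ge0 := slope_curve_kap_ge0 slc.
Let kap_p := slope_curve_kap slc.
Let G_ge0 := slope_curve_ge0 slc.
Let energy_drop_le := slope_curve_drop slc.
Let Gq_lsc := slope_curve_lsc slc.

Lemma slope_power_finite s eta : (Gq s <= eta%:E)%E ->
  exists g, [/\ 0 <= g, G s = g%:E & g `^ q <= eta].
Proof.
have q0 := conj_exponent_gt0 p1 pq.
case: (G s) (G_ge0 s) => [g|_|//].
  by rewrite lee_fin poweR_EFin lee_fin => g0 gq; exists g.
by rewrite poweRyr ?gt_eqF.
Qed.

Lemma slope_power_ge0 s : (0 <= Gq s)%E. Proof. exact: poweR_ge0. Qed.

(** [d^p0 = d^(p0-p) d^p], where the first factor is bounded on [[0,T]] and the
    second is controlled by [dist_powR_le]. *)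
Lemma convexity_error_le T : co_itv a T ->
  exists2 k : R, 0 <= k & (kap = 0 -> k = 0) /\
  forall s t, 0 <= s -> s < t -> t <= T ->
   kap * mdist (u s) (u t) `^ p0 <= k * ((E s - E t) * (t - s) `^ (p - 1)).
Proof.
move=> aT; have pp := exponent_gt0 p1.
pose M := (E 0 - E T) * T `^ (p - 1).
pose k := kap * (M `^ p^-1) `^ (p0 - p).
exists k; first by rewrite mulr_ge0 ?powR_ge0.
split => [k0|s t s0 st tT]; first by rewrite /k k0 mul0r.
have at_ : co_itv a t by apply: co_itv_le aT _ _; lra.
have as_ : co_itv a s by apply: co_itv_le aT _ _; lra.
have a0 : co_itv a 0 by apply: co_itv_le aT _ _; lra.
have B := dist_powR_le p1 pq enc at_ s0 st.
case: kap_p => [k0|pp0]; first by rewrite /k k0 !mul0r.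
rewrite /k -mulrA ler_wpM2l//.
have := mdist_ge0 (u s) (u t); rewrite le_eqVlt => /predU1P[<-|d0].
  rewrite powR0 ?gt_eqF ?(lt_le_trans pp)// mulr_ge0 ?powR_ge0// mulr_ge0 ?powR_ge0//.
  by rewrite subr_ge0 E_dec// ltW.
have -> : mdist (u s) (u t) `^ p0 = mdist (u s) (u t) `^ (p0 - p) * mdist (u s) (u t) `^ p.
  rewrite -powRD; first by congr (_ `^ _); lra.
  by rewrite (gt_eqF d0) implybT.
apply: ler_pM => //; rewrite ?powR_ge0//.
apply: ge0_ler_powR; rewrite ?nnegrE ?powR_ge0 ?mdist_ge0 ?subr_ge0//.
have -> : mdist (u s) (u t) = (mdist (u s) (u t) `^ p) `^ p^-1.
  by rewrite -powRrM divff ?gt_eqF// powRr1// ltW.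
apply: ge0_ler_powR; rewrite ?nnegrE ?powR_ge0 ?invr_ge0 ?(ltW pp)//.
  by rewrite mulr_ge0 ?powR_ge0// subr_ge0 E_dec//; lra.
apply: (le_trans B); apply: ler_pM; rewrite ?powR_ge0 ?subr_ge0//.
- by rewrite E_dec// ltW.
- have := E_dec a0 as_ s0; have := E_dec at_ aT tT; lra.
apply: ge0_ler_powR; rewrite ?nnegrE ?subr_ge0 ?(ltW p1) ?(ltW st)//; lra.
Qed.

(** Young's inequality splits [g d] into [g^q h / q] and [d^p / (p h^(p-1))], and
    the latter is at most the fraction [1 / p] of the energy drop, which can be
    absorbed on the left. *)
Lemma energy_drop_le_slope_power T : co_itv a T ->
  exists2 k : R, 0 <= k & (kap = 0 -> k = 0) /\
  forall s t, 0 <= s -> s < t -> t <= T ->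
   kap * mdist (u s) (u t) `^ p0 <= k * ((E s - E t) * (t - s) `^ (p - 1)) /\
   forall eta, (Gq s <= eta%:E)%E ->
     (E s - E t) * (1 - k * (t - s) `^ (p - 1)) <= eta * (t - s).
Proof.
move=> aT; have pp := exponent_gt0 p1; have q0 := conj_exponent_gt0 p1 pq; have q1 := conj_exponent_gt1 p1 pq.
have [k k0 [kk0 kP]] := convexity_error_le aT.
exists (q * k); first by rewrite mulr_ge0// ltW.
split => [/kk0 ->|s t s0 st tT]; first by rewrite mulr0.
have at_ : co_itv a t by apply: co_itv_le aT _ _; lra.
have as_ : co_itv a s by apply: co_itv_le aT _ _; lra.
have B := dist_powR_le p1 pq enc at_ s0 st.
have kB := kP s t s0 st tT.
have D0 : 0 <= E s - E t by rewrite subr_ge0 E_dec// ltW.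
split.
  apply: (le_trans kB); apply: ler_wpM2r; first by rewrite mulr_ge0// powR_ge0.
  by rewrite ler_peMl// ltW.
move=> eta /slope_power_finite[g [g0 Gs geta]].
have := energy_drop_le as_ at_ Gs.
set d := mdist (u s) (u t) in B kB *; set D := E s - E t in B kB D0 *.
have h0 : 0 < t - s by rewrite subr_gt0.
set h := t - s in B kB h0 *.
have gd : g * d <= eta * h / q + D / p.
  have P1 : 0 < h `^ (p - 1) by rewrite powR_gt0.
  have := @conjugate_powR _ (d * h `^ (- q^-1)) (g * h `^ q^-1) p q.
  rewrite !mulr_ge0 ?powR_ge0 ?mdist_ge0// => /(_ isT isT pp q0 pq).
  have -> : d * h `^ (- q^-1) * (g * h `^ q^-1) = g * d.
    rewrite powRN mulrACA mulVf ?mulr1 1?mulrC// gt_eqF// powR_gt0//.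
  have -> : (g * h `^ q^-1) `^ q = g `^ q * h.
    by rewrite powRM ?powR_ge0// -powRrM mulVf ?gt_eqF// powRr1// ltW.
  have -> : (d * h `^ (- q^-1)) `^ p = d `^ p / h `^ (p - 1).
    rewrite powRM ?powR_ge0 ?mdist_ge0// -powRrM -powRN; congr (_ * _ `^ _).
    by rewrite -{1}(conj_exponentE p1 pq) mulNr mulrCA mulVf ?gt_eqF// mulr1.
  move=> /le_trans; apply; rewrite addrC; apply: lerD.
    by rewrite ler_pM2r ?invr_gt0// ler_pM2r.
  by rewrite ler_pM2r ?invr_gt0// ler_pdivrMr.
move=> DD.
have : D <= eta * h / q + D / p + k * (D * h `^ (p - 1)) by lra.
have -> : D / p = D - D / q.
  by rewrite (_ : p^-1 = 1 - q^-1); [rewrite mulrBr mulr1 | move: pq; lra].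
move=> {}DD.
have : D / q <= (eta * h + q * k * (D * h `^ (p - 1))) / q.
  rewrite [leRHS](_ : _ = eta * h / q + k * (D * h `^ (p - 1))); first by lra.
  by field; rewrite gt_eqF.
rewrite ler_pM2r ?invr_gt0//; lra.
Qed.

(** The barrier argument. [psi] increases towards [c < G(t)^q] at time [t]; at the
    last time [r] at which [G^q] is below [psi], the energy lost on [[r,t]] would
    be too large for the bound in terms of [G(r)^q <= psi r]. *)
Lemma slope_power_growth (T k B s t c : R) : co_itv a T -> 0 <= k ->
  (forall s t : R, 0 <= s -> s < t -> t <= T -> forall eta, (Gq s <= eta%:E)%E ->
     (E s - E t) * (1 - k * (t - s) `^ (p - 1)) <= eta * (t - s)) ->
  k < B * (1 - 2^-1 `^ (p - 1)) / 2 ->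
  0 <= s -> s < t -> t <= T -> B * (t - s) `^ (p - 1) <= 1 ->
  (c%:E < Gq t)%E -> ((c * (1 - B * (t - s) `^ (p - 1)))%:E <= Gq s)%E.
Proof.
move=> aT k0 kP kB s0 st tT Bh ct; rewrite leNgt; apply/negP => sc.
have p10 : 0 < p - 1 by rewrite subr_gt0.
set z := 2^-1 `^ (p - 1) in kB.
have z0 : 0 <= z by exact: powR_ge0.
have z1 : z < 1 by exact: powR_half_lt1.
have B0 : 0 < B.
  rewrite ltNge; apply/negP => B0.
  have : B * (1 - z) <= 0 by rewrite mulr_le0_ge0// subr_ge0 ltW.
  by lra.
pose psi r := c * (1 - B * (t - r) `^ (p - 1)).
have at_ : co_itv a t by apply: co_itv_le aT _ _; lra.
have psis : 0 < psi s by rewrite -lte_fin; apply: le_lt_trans sc; exact: slope_power_ge0.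
have c0 : 0 < c.
  rewrite ltNge; apply/negP => c0; move: psis; rewrite /psi ltNge.
  by rewrite mulr_le0_ge0// subr_ge0.
have psi_le x y : s <= x -> x <= y -> y <= t -> psi x <= psi y.
  move=> sx xy yt; rewrite /psi ler_pM2l// lerB// ler_pM2l//.
  by apply: ge0_ler_powR; rewrite ?nnegrE ?(ltW p10)//; lra.
pose Z := [set x | s <= x <= t /\ (Gq x <= (psi x)%:E)%E].
have Zs : Z s by split; [rewrite lexx ltW | exact: ltW].
have supZ : has_sup Z by split; [exists s | exists t => x [] /andP[]].
pose r := sup Z.
have sr : s <= r by exact: sup_upper_bound.
have rt : r <= t by apply: ge_sup; [exists s | move=> x [] /andP[]].
have ar : co_itv a r by apply: co_itv_le at_ _ _; lra.
have Hr : (Gq r <= (psi r)%:E)%E.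
  rewrite leNgt; apply/negP => /(Gq_lsc ar)[d d0 dP].
  have [x [/andP[sx xt] Hx] rx] := sup_adherent d0 supZ.
  have xr : x <= r by apply: sup_upper_bound => //; split => //; rewrite sx.
  have : ((psi r)%:E < Gq x)%E.
    apply: dP; first by apply: co_itv_le at_ _ _; lra.
    by rewrite ltr_norml -/r in rx *; apply/andP; split; lra.
  by rewrite ltNge (le_trans Hx)// lee_fin psi_le.
have ltrt : r < t.
  rewrite lt_neqAle rt andbT; apply/eqP => e; move: Hr.
  by rewrite e /psi subrr powR0 ?gt_eqF// mulr0 subr0 mulr1 leNgt ct.
have Hgt x : r < x -> x < t -> ((psi x)%:E <= Gq x)%E.
  move=> rx xt; rewrite leNgt; apply/negP => Hx.
  have : x <= r.
    apply: sup_upper_bound => //; split; last exact: ltW.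
    by rewrite !ltW//; apply: le_lt_trans rx.
  by rewrite leNgt rx.
have h0 : 0 < t - r by rewrite subr_gt0.
(* As [psi] increases, its values at [r] and at the midpoint [m] bound it from
   below on the two halves of [[r,t]]; the gain at [m] is the factor [z < 1]. *)
pose m := (r + t) / 2.
have rm : r < m by rewrite /m; lra.
have mt : m < t by rewrite /m; lra.
have am : co_itv a m by apply: co_itv_le at_ _ _; lra.
have D1 : psi r * (m - r) <= E r - E m.
  apply: (energy_drop_ge enc am) => //; try lra.
  move=> x /andP[rx xm]; apply: le_trans (Hgt x _ _); rewrite ?lee_fin ?psi_le//; lra.
have D2 : psi m * (t - m) <= E m - E t.
  apply: (energy_drop_ge enc at_) => //; try lra.
  move=> x /andP[rx xm]; apply: le_trans (Hgt x _ _); rewrite ?lee_fin ?psi_le//; lra.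
have := kP r t ltac:(lra) ltrt tT _ Hr.
set y := (t - r) `^ (p - 1).
have y0 : 0 < y by rewrite powR_gt0.
have By : B * y <= 1.
  apply: le_trans Bh; rewrite ler_pM2l//.
  by apply: ge0_ler_powR; rewrite ?nnegrE ?(ltW p10)//; lra.
have ky : k * y < B * y * (1 - z) / 2.
  by rewrite -(ltr_pM2r y0) in kB; move: kB; lra.
have psim : psi m = c * (1 - B * (z * y)).
  rewrite /psi; congr (_ * (1 - _ * _)).
  rewrite /z /y -powRM ?invr_ge0 ?(ltW h0)//; congr (_ `^ _).
  by rewrite /m; field.
have psir : psi r = c * (1 - B * y) by [].
have Dge : c * (1 - B * y * (1 + z) / 2) * (t - r) <= E r - E t.
  move: D1 D2; rewrite psim psir (_ : m - r = (t - r) / 2); last by rewrite /m; field.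
  by rewrite (_ : t - m = (t - r) / 2); last rewrite /m; [lra | field].
have ky1 : 0 <= 1 - k * y.
  have : B * y * (1 - z) <= 1 * (1 - z) by rewrite ler_wpM2r//; lra.
  lra.
have := ler_wpM2r ky1 Dge.
rewrite psir => le1 le2.
have := le_trans le1 le2.
rewrite -!mulrA ler_pM2l// mulrCA [leRHS]mulrC ler_pM2l// => le3.
have : 0 <= k * y * (B * y * (1 + z) / 2).
  by rewrite !mulr_ge0 ?(ltW y0) ?(ltW B0)//; lra.
lra.
Qed.

Lemma slope_control T : co_itv a T -> exists k B : R,
  [/\ 0 <= k, 0 < B,
    forall s t, 0 <= s -> s < t -> t <= T ->
      kap * mdist (u s) (u t) `^ p0 <= k * ((E s - E t) * (t - s) `^ (p - 1)) /\
      forall eta, (Gq s <= eta%:E)%E ->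
        (E s - E t) * (1 - k * (t - s) `^ (p - 1)) <= eta * (t - s) &
    forall s t c, 0 <= s -> s < t -> t <= T -> B * (t - s) `^ (p - 1) <= 1 ->
      (c%:E < Gq t)%E -> ((c * (1 - B * (t - s) `^ (p - 1)))%:E <= Gq s)%E].
Proof.
move=> aT.
have [k k0 [_ kP]] := energy_drop_le_slope_power aT.
have z1 : (2^-1 : R) `^ (p - 1) < 1 by rewrite powR_half_lt1// subr_gt0.
(* This [B] makes [B (1 - 2^-(p-1)) / 2] equal to [k + 1 / 2]. *)
exists k, ((2 * k + 1) / (1 - 2^-1 `^ (p - 1))); split => //.
  by rewrite divr_gt0 ?subr_gt0//; lra.
move=> s t c; apply: (slope_power_growth aT k0).
  by move=> s' t' s0 st tT eta Heta; apply: (kP s' t' s0 st tT).2.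
by rewrite divfK ?subr_eq0 ?gt_eqF//; lra.
Qed.

(** At distances below [d] both correction terms are at most 1/2. *)
Lemma slope_control_half T : co_itv a T -> exists2 d : R, 0 < d &
  (forall s t eta, 0 <= s -> s < t -> t <= T -> t - s < d -> 0 < eta ->
      (Gq s < eta%:E)%E -> (Gq t <= (2 * eta)%:E)%E) /\
  (forall s t eta, 0 <= s -> s < t -> t <= T -> t - s < d ->
      (Gq s <= eta%:E)%E -> E s - E t <= 2 * eta * (t - s)).
Proof.
move=> aT; have [k [B [k0 B0 kP BP]]] := slope_control aT.
have p10 : 0 < p - 1 by rewrite subr_gt0.
have K0 : 0 < 2 * (k + B) by lra.
have [|d d0 dP] := @powR_small _ (p - 1) ((2 * (k + B))^-1) p10; first by rewrite invr_gt0.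
have dP2 h : 0 <= h -> h < d -> B * h `^ (p - 1) <= 1 / 2 /\ k * h `^ (p - 1) <= 1 / 2.
  move=> h0 hd; have := dP h h0 hd; rewrite -[_^-1]mul1r ltr_pdivlMr//.
  have x0 : 0 <= h `^ (p - 1) by exact: powR_ge0.
  have := mulr_ge0 k0 x0; have := mulr_ge0 (ltW B0) x0; lra.
exists d => //; split.
  move=> s t eta s0 st tT td eta0 Hs; rewrite leNgt; apply/negP => Ht.
  have [Bh _] := dP2 (t - s) ltac:(lra) td.
  have := BP s t _ s0 st tT ltac:(lra) Ht.
  rewrite leNgt (lt_le_trans Hs)// lee_fin.
  set x := B * _ in Bh *.
  have : eta * x <= eta * (1 / 2) by rewrite ler_pM2l.
  lra.
move=> s t eta s0 st tT td Hs.
have [_ kh] := dP2 (t - s) ltac:(lra) td.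
have [_ /(_ _ Hs)] := kP s t s0 st tT.
set x := k * _ in kh *.
have D0 : 0 <= E s - E t.
  rewrite subr_ge0; apply: E_dec (ltW st); apply: co_itv_le aT _ _; lra.
have : (E s - E t) * x <= (E s - E t) * (1 / 2) by rewrite ler_wpM2l.
lra.
Qed.

(** Otherwise the energy lost on [(s,t)] would exceed [E s - E t]. *)
Lemma exists_small_slope s t : co_itv a t -> 0 <= s -> s < t ->
  exists r eta, [/\ s < r < t, 0 < eta & (Gq r < eta%:E)%E].
Proof.
move=> at_ s0 st.
have h0 : 0 < t - s by rewrite subr_gt0.
have D0 : 0 <= E s - E t.
  by rewrite subr_ge0; apply: E_dec (ltW st) => //; apply: co_itv_le at_ _ _ => //; exact: ltW.
pose eta := (E s - E t) / (t - s) + 1.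
have eta0 : 0 < eta by rewrite ltr_wpDl// divr_ge0// ltW.
apply: contrapT => nex.
have : eta * (t - s) <= E s - E t.
  apply: (energy_drop_ge enc at_ s0 (ltW st)) => x sxt.
  by rewrite leNgt; apply/negP => Hx; apply: nex; exists x, eta.
by rewrite /eta mulrDl divfK ?gt_eqF//; lra.
Qed.

Lemma slope_finite t : oo_itv a t -> exists2 eta, 0 < eta & (Gq t <= eta%:E)%E.
Proof.
move=> [t0 ta]; have at_ : co_itv a t by split => //; exact: ltW.
have [d d0 [dP _]] := slope_control_half at_.
pose s := Num.max 0 (t - d / 2).
have s0 : 0 <= s by rewrite le_max lexx.
have std : t - d / 2 <= s by rewrite le_max lexx orbT.
have st : s < t by rewrite gt_max t0/=; lra.
have [r [eta [/andP[sr rt] eta0 Hr]]] := exists_small_slope at_ s0 st.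
exists (2 * eta); first lra.
by apply: (dP r t) => //; lra.
Qed.

Lemma slope_curve_lipschitz t : oo_itv a t -> exists L : R, exists2 V, nbhs t V &
  forall s1 s2, (co_itv a `&` V) s1 -> (co_itv a `&` V) s2 -> s1 < s2 ->
    E s1 - E s2 <= L * (s2 - s1) /\ mdist (u s1) (u s2) <= L * (s2 - s1).
Proof.
move=> [t0 ta]; have at_ : co_itv a t by split => //; exact: ltW.
have [T aT tT] := co_itv_right at_.
have [d d0 [dP dE]] := slope_control_half aT.
pose s := Num.max 0 (t - d / 2).
have s0 : 0 <= s by rewrite le_max lexx.
have std : t - d / 2 <= s by rewrite le_max lexx orbT.
have st : s < t by rewrite gt_max t0/=; lra.
have [r [eta [/andP[sr rt] eta0 Hr]]] := exists_small_slope at_ s0 st.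
pose t' := Num.min T (t + d / 2).
have t'T : t' <= T by rewrite ge_min lexx.
have t'd : t' <= t + d / 2 by rewrite ge_min lexx orbT.
have tt' : t < t' by rewrite lt_min tT/=; lra.
have e40 : 0 < 4 * eta by lra.
exists (Num.max (4 * eta) ((4 * eta) `^ p^-1)), [set x | r < x < t'].
  have := @near_in_itvoo _ r t' t; rewrite in_itv/= rt tt' => /(_ isT).
  by apply: filterS => x /=; rewrite in_itv.
move=> s1 s2 [a1 /= /andP[rs1 s1t']] [a2 /= /andP[rs2 s2t']] s12.
have h0 : 0 < s2 - s1 by rewrite subr_gt0.
have H1 : (Gq s1 <= (2 * eta)%:E)%E by apply: (dP r s1) => //; lra.
have D1 : E s1 - E s2 <= 4 * eta * (s2 - s1).
  by have := dE s1 s2 _ ltac:(lra) s12 ltac:(lra) ltac:(lra) H1; lra.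
split.
  by apply: (le_trans D1); rewrite ler_pM2r// le_max lexx.
have pp := exponent_gt0 p1.
apply: (@le_trans _ _ ((4 * eta) `^ p^-1 * (s2 - s1))); last first.
  by rewrite ler_pM2r// le_max lexx orbT.
have B := dist_powR_le p1 pq enc a2 a1.1 s12.
have B2 : mdist (u s1) (u s2) `^ p <= 4 * eta * (s2 - s1) `^ p.
  apply: (le_trans B); rewrite -(mulr_powRB1 (ltW h0) pp) mulrA.
  by rewrite ler_wpM2r// powR_ge0.
have : (mdist (u s1) (u s2) `^ p) `^ p^-1 <= (4 * eta * (s2 - s1) `^ p) `^ p^-1.
  apply: ge0_ler_powR; rewrite ?nnegrE ?invr_ge0 ?powR_ge0 ?(ltW pp)//.
  by rewrite mulr_ge0 ?powR_ge0// ltW.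
rewrite powRM ?powR_ge0 ?(ltW e40)// -!powRrM divff ?gt_eqF//.
by rewrite !powRr1 ?mdist_ge0// ltW.
Qed.

(** The lower bound for the difference quotient comes from lower
    semicontinuity of the slope, the upper bound from
    [energy_drop_le_slope_power]. Both rely on the slope at [t] alone, so that
    [t = 0] is covered. *)
Lemma energy_right_derivative t eta : co_itv a t -> Gq t = eta%:E ->
  (E t - E (t + h)) / h @[h --> 0^'+] --> eta.
Proof.
move=> at_ Ht; have [T aT nT] := near_right_co at_.
have [k [B [k0 B0 kP BP]]] := slope_control aT.
have p10 : 0 < p - 1 by rewrite subr_gt0.
apply: cvgr_between => c.
  move=> ceta; pose c' := (c + eta) / 2.
  have [|d d0 dP] := @Gq_lsc t c' at_; first by rewrite Ht lte_fin /c'; lra.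
  near=> h.
  have [h0 hT] : 0 < h /\ t + h <= T by near: h.
  have hd : h < d by near: h; exact: nbhs_right_lt.
  have ath : co_itv a (t + h) by apply: co_itv_le aT _ _ => //; have := at_.1; lra.
  apply: (@lt_le_trans _ _ c'); first by rewrite /c'; lra.
  rewrite ler_pdivlMr//.
  have := energy_drop_ge enc ath at_.1 (c := c').
  rewrite [t + h - t](_ : _ = h); last by lra.
  apply; first lra.
  move=> x /andP[tx xh]; apply: ltW; apply: dP.
    by apply: co_itv_le ath _ _; have := at_.1; lra.
  by rewrite gtr0_norm; lra.
move=> etac.
have eta0 : 0 <= eta by rewrite -lee_fin -Ht slope_power_ge0.
have c0 : 0 < c by lra.
have e0 : 0 < 1 - eta / c by rewrite subr_gt0 ltr_pdivrMr// mul1r.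
near=> h.
have [h0 hT] : 0 < h /\ t + h <= T by near: h.
have kh : k * h `^ (p - 1) < 1 - eta / c by near: h; exact: powR_near0.
rewrite ltr_pdivrMr//.
have [_ /(_ eta)] := kP t (t + h) at_.1 ltac:(lra) hT.
rewrite Ht lexx [t + h - t](_ : _ = h); last by lra.
move=> /(_ isT); set D := E t - _; set x := k * _ in kh *.
move=> Dx; rewrite ltNge; apply/negP => cD.
have : c * h * (1 - x) <= D * (1 - x).
  by rewrite ler_wpM2r//; have : 0 <= eta / c by [rewrite divr_ge0// ltW]; lra.
have : c * h * (eta / c) < c * h * (1 - x) by rewrite ltr_pM2l ?mulr_gt0//; lra.
rewrite (_ : c * h * (eta / c) = eta * h); last by field; rewrite gt_eqF.
lra.
Unshelve. all: end_near.
Qed.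

(** For [g > 0] the quotient [g d / h] is squeezed between the energy quotient
    times [1 - k h^(p-1)] and its Young bound [(D / h) / p + g^q / q], both of
    which tend to [g^q]. For [g = 0] the bound [d^p <= D h^(p-1)] suffices. *)
Lemma metric_right_derivative t g : co_itv a t -> 0 <= g -> G t = g%:E ->
  mdist (u (t + h)) (u t) / h @[h --> 0^'+] --> g `^ (q - 1).
Proof.
move=> at_ g0 Gt; have [T aT nT] := near_right_co at_.
have Ht : Gq t = (g `^ q)%:E by rewrite Gt poweR_EFin.
have Ed := energy_right_derivative at_ Ht.
have [k [B [k0 B0 kP BP]]] := slope_control aT.
have p10 : 0 < p - 1 by rewrite subr_gt0.
have q1 := conj_exponent_gt1 p1 pq; have q0 := conj_exponent_gt0 p1 pq; have pp := exponent_gt0 p1.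
move: g0; rewrite le_eqVlt => /predU1P[g0|g0].
  rewrite -g0 powR0; last by rewrite gt_eqF// subr_gt0.
  apply: cvgr_between => c c0; near=> h.
    have h0 : 0 < h by near: h; exact: nbhs_right_gt.
    by apply: (lt_le_trans c0); rewrite divr_ge0 ?mdist_ge0// ltW.
  have [h0 hT] : 0 < h /\ t + h <= T by near: h.
  have ath : co_itv a (t + h) by apply: co_itv_le aT _ _ => //; have := at_.1; lra.
  have Dh : (E t - E (t + h)) / h < c `^ p.
    near: h; apply: (cvgr_lt _ Ed).
    by rewrite -g0 powR0 ?gt_eqF// powR_gt0.
  have tth : t < t + h by lra.
  have := dist_powR_le p1 pq enc ath at_.1 tth.
  rewrite [t + h - t](_ : _ = h); last by lra.
  rewrite metric_sym => B1; rewrite ltr_pdivrMr// ltNge; apply/negP => cd.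
  have : (c * h) `^ p <= mdist (u (t + h)) (u t) `^ p.
    by apply: ge0_ler_powR; rewrite ?nnegrE ?mdist_ge0 ?mulr_ge0 ?(ltW pp) ?(ltW h0) ?(ltW c0).
  rewrite leNgt (le_lt_trans B1)// powRM ?(ltW c0) ?(ltW h0)// -(mulr_powRB1 (ltW h0) pp) mulrA.
  by rewrite ltr_pM2r ?powR_gt0// -ltr_pdivrMr.
suff : g * (mdist (u (t + h)) (u t) / h) @[h --> 0^'+] --> g `^ q.
  move=> gd.
  have -> : g `^ (q - 1) = g^-1 * g `^ q.
    by rewrite -(mulr_powRB1 (ltW g0) q0) mulrA mulVf ?mul1r// gt_eqF.
  rewrite (_ : (fun h => _) = (fun h => g^-1 * (g * (mdist (u (t + h)) (u t) / h)))).
    by apply: cvgM gd; exact: cvg_cst.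
  by apply/funext => h; rewrite mulrA mulVf ?mul1r// gt_eqF.
have kh0 : 1 - k * h `^ (p - 1) @[h --> 0^'+] --> (1 : R).
  rewrite -[X in _ --> X]subr0; apply: cvgB; first exact: cvg_cst.
  by rewrite -[X in _ --> X](mulr0 k); apply: cvgM; [exact: cvg_cst | exact: powR_cvg0].
apply: (@squeeze_cvgr _ _ _ _
  (fun h => (E t - E (t + h)) / h * (1 - k * h `^ (p - 1)))
  (fun h => (E t - E (t + h)) / h / p + g `^ q / q)).
- near=> h.
  have [h0 hT] : 0 < h /\ t + h <= T by near: h.
  have ath : co_itv a (t + h) by apply: co_itv_le aT _ _ => //; have := at_.1; lra.
  have tth : t < t + h by lra.
  have thh : t + h - t = h by lra.
  rewrite metric_sym; apply/andP; split.
    rewrite mulrAC [leRHS]mulrA ler_pM2r ?invr_gt0//.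
    have [+ _] := kP t (t + h) at_.1 tth hT.
    have := energy_drop_le at_ ath Gt; rewrite thh; lra.
  have := dist_young p1 pq enc ath at_.1 (ltW tth) g0.
  rewrite thh => Y; rewrite mulrA ler_pdivrMr//; apply: (le_trans Y).
  rewrite [leRHS](_ : _ = (E t - E (t + h)) / p + h * g `^ q / q)//.
  by field; rewrite !gt_eqF.
- by rewrite -[X in _ --> X]mulr1; apply: cvgM.
- rewrite [X in _ --> X](_ : _ = g `^ q / p + g `^ q / q); last by rewrite -mulrDr pq mulr1.
  by apply: cvgD; [apply: cvgM; [exact: Ed | exact: cvg_cst] | exact: cvg_cst].
Unshelve. all: end_near.
Qed.

(** The lower bound is lower semicontinuity, which is the whole assertion at a
    time of infinite slope; the upper bound is [slope_power_growth] with [t] as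
    the earlier time. *)
Lemma slope_right_continuous t : co_itv a t -> G t' @[t' --> t^'+] --> G t.
Proof.
move=> at_; have q0 := conj_exponent_gt0 p1 pq.
have [T aT tT] := co_itv_right at_.
have near_co : \forall t' \near t^'+, t < t' /\ co_itv a t'.
  near=> t'.
  have tt' : t < t' by near: t'; exact: nbhs_right_gt.
  split => //; apply: co_itv_le aT _ _; first by have := at_.1; lra.
  by apply: ltW; near: t'; exact: nbhs_right_lt.
have GqE (x : R) (c : R) : 0 <= c -> (c%:E < G x)%E = ((c `^ q)%:E < Gq x)%E.
  by move=> c0; rewrite poweR_lt.
apply: cvge_between => // c.
  have [c0|c0] := ltP c 0.
    by move=> _; near=> t'; rewrite (lt_le_trans _ (G_ge0 t'))// lte_fin.
  rewrite GqE// => /(Gq_lsc at_)[d d0 dP]; near=> t'.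
  have [tt' at'] : t < t' /\ co_itv a t' by near: t'.
  rewrite GqE//; apply: dP => //; rewrite gtr0_norm ?subr_gt0//.
  suff : t' < t + d by lra.
  by near: t'; apply: nbhs_right_lt; lra.
case E1 : (G t) (G_ge0 t) => [g|//|//]; rewrite lee_fin lte_fin => g0 gc.
have [k [B [k0 B0 kP BP]]] := slope_control aT.
have p10 : 0 < p - 1 by rewrite subr_gt0.
pose c1 := (g + c) / 2.
have c10 : 0 < c1 by rewrite /c1; lra.
have gc1 : g `^ q < c1 `^ q by apply: gt0_ltr_powR; rewrite ?nnegrE//; rewrite /c1; lra.
have gq0 : 0 <= g `^ q by exact: powR_ge0.
have e0 : 0 < 1 - g `^ q / c1 `^ q.
  by rewrite subr_gt0 ltr_pdivrMr ?mul1r// powR_gt0.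
have [d d0 dP] : exists2 d : R, 0 < d & forall h, 0 < h -> h < d ->
    B * h `^ (p - 1) < 1 - g `^ q / c1 `^ q.
  have [|d d0 dP] := @powR_small _ (p - 1) ((1 - g `^ q / c1 `^ q) / B) p10.
    by rewrite divr_gt0.
  exists d => // h h0 hd; rewrite mulrC -ltr_pdivlMr//; apply: dP => //; exact: ltW.
near=> t'.
have [tt' at'] : t < t' /\ co_itv a t' by near: t'.
have t'T : t' <= T by apply: ltW; near: t'; exact: nbhs_right_lt.
have t'd : t' < t + d by near: t'; apply: nbhs_right_lt; lra.
rewrite ltNge; apply/negP => cG.
have : (c1%:E < G t')%E by apply: lt_le_trans cG; rewrite lte_fin /c1; lra.
rewrite GqE ?(ltW c10)// => c1H.
have Bh := dP (t' - t) ltac:(lra) ltac:(lra).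
have := BP t t' _ at_.1 tt' t'T _ c1H.
have g1 : 0 <= g `^ q / c1 `^ q by rewrite divr_ge0// powR_ge0.
rewrite E1 poweR_EFin lee_fin => /(_ ltac:(lra)).
set x := B * _ in Bh *.
have : c1 `^ q * (g `^ q / c1 `^ q) < c1 `^ q * (1 - x).
  by rewrite ltr_pM2l ?powR_gt0//; lra.
rewrite mulrC divfK ?gt_eqF ?powR_gt0//; lra.
Unshelve. all: end_near.
Qed.

(** With [kap = 0] the constant [k] vanishes and [B] can be chosen so small that
    the loss factor in [slope_power_growth] is as close to 1 as desired. *)
Lemma slope_power_nonincreasing s t : kap = 0 -> co_itv a t ->
  0 <= s -> s < t -> (Gq t <= Gq s)%E.
Proof.
move=> kap0 at_ s0 st; have p10 : 0 < p - 1 by rewrite subr_gt0.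
have [k k0 [/(_ kap0) kk kP]] := energy_drop_le_slope_power at_.
have z1 : (2^-1 : R) `^ (p - 1) < 1 by rewrite powR_half_lt1// subr_gt0.
rewrite leNgt; apply/negP.
case E1 : (Gq s) (slope_power_ge0 s) => [eta| |//]; last first.
  by move=> _; rewrite ltNge leey.
rewrite lee_fin => eta0 GqE.
have [c etac cH] : exists2 c, eta < c & (c%:E < Gq t)%E.
  case: (Gq t) GqE => [r|_|//]; last by exists (eta + 1); rewrite ?ltry//; lra.
  by rewrite lte_fin => er; exists ((eta + r) / 2); rewrite ?lte_fin; lra.
have c0 : 0 < c by lra.
have h0 : 0 < (t - s) `^ (p - 1) by rewrite powR_gt0// subr_gt0.
have e0 : 0 < 1 - eta / c by rewrite subr_gt0 ltr_pdivrMr// mul1r.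
(* With this [B], the bound [c (1 - B h^(p-1))] is the mean of [c] and [eta]. *)
pose B := (1 - eta / c) / 2 / (t - s) `^ (p - 1).
have B0 : 0 < B by rewrite !divr_gt0.
have BE : B * (t - s) `^ (p - 1) = (1 - eta / c) / 2 by rewrite divfK// gt_eqF.
have ec : 0 <= eta / c by rewrite divr_ge0// ltW.
have := @slope_power_growth t k B s t c at_ k0.
rewrite BE E1 lee_fin => /(_ _ _ s0 st (lexx t) _ cH) K.
have : c * (1 - (1 - eta / c) / 2) <= eta.
  apply: K; last lra.
  - by move=> s' t' s0' st' tT eta' Heta; apply: (kP s' t' s0' st' tT).2.
  - by rewrite kk divr_gt0// mulr_gt0// subr_gt0.
have -> : c * (1 - (1 - eta / c) / 2) = (c + eta) / 2 by field; rewrite gt_eqF.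
lra.
Qed.

Lemma slope_power_le_drop s t c : kap = 0 -> co_itv a t ->
  0 <= s -> s < t -> (c%:E <= Gq t)%E ->
  c * (t - s) <= E s - E t.
Proof.
move=> kap0 at_ s0 st cH.
apply: (energy_drop_ge enc at_ s0 (ltW st)) => x /andP[sx xt].
apply: (le_trans cH); apply: slope_power_nonincreasing => //; lra.
Qed.

End slope_curve.

(** * Minimizers *)

Section minimizers.
Context {R : realType} {S : completeMetricType R}.
Variables (f : S -> \bar R) (p0 lam : R).
Hypothesis fNy : forall v, (-oo < f v)%E.
Hypothesis p00 : 0 < p0.
Hypothesis lam0 : 0 < lam.
Hypothesis cvx : plambda_convex p0 lam f.

(** A minimizer has slope 0. *)
Lemma minimizer_growth v w x y : minimizer f v -> f v = x%:E -> (f w <= y%:E)%E ->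
  lam * mdist v w `^ p0 <= y - x.
Proof.
move=> vmin fv fw.
have slope0 : (local_slope f v <= 0%:E)%E.
  apply: (slope_le_near fNy fv (lexx 0)) => g' g0; exists 1 => // v' z _ _ fv'.
  have := vmin v'; rewrite fv fv' lee_fin => xz.
  by have := mulr_ge0 (ltW g0) (mdist_ge0 v v'); lra.
by have := slope_global fNy p00 cvx fv fw slope0; lra.
Qed.

(** Two points of energy close to the infimum are close to each other, because
    the energy at an intermediate point of the connecting curve cannot be below
    the infimum. The sublevel sets above the infimum thus generate a Cauchy
    filter. *)
Lemma exists_minimizer (r0 : R) : lower_semicontinuous f -> eproper f ->
  (forall w, (r0%:E <= f w)%E) -> exists v, minimizer f v.
Proof.
move=> flsc [v0 fv0] flb.
have [psi [psi01 _ [t t01 psit] H]] := cvx.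
have [t0 t1] := andP t01.
pose c := lam * t * (1 - psi t).
have c0 : 0 < c by rewrite !mulr_gt0// subr_gt0.
have infr : (r0%:E <= ereal_inf (range f))%E.
  by apply: le_ereal_inf_tmp => _ [w _ <-].
have : (ereal_inf (range f) < +oo)%E.
  by apply: le_lt_trans fv0; apply: ereal_inf_lbound; exists v0.
case E : (ereal_inf (range f)) infr => [r|//|//] _ _.
have rf w : (r%:E <= f w)%E by rewrite -E; apply: ereal_inf_lbound; exists w.
pose F := filter_from [set e : R | 0 < e] (fun e => [set v | (f v < (r + e)%:E)%E]).
have FF : ProperFilter F.
  apply: filter_from_proper; last first.
    move=> e /= e0; have : (ereal_inf (range f) < (r + e)%:E)%E by rewrite E lte_fin; lra.
    by move=> /ereal_inf_lt[_ [w _ <-] we]; exists w.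
  apply: filter_from_filter; first by exists 1 => /=.
  move=> e1 e2 /= e10 e20; exists (Num.min e1 e2); first by rewrite /= lt_min e10.
  by move=> v /= fv; split; apply: (lt_le_trans fv); rewrite lee_fin lerD2l ge_min lexx ?orbT.
have close e v w : (f v < (r + e)%:E)%E -> (f w < (r + e)%:E)%E -> c * mdist v w `^ p0 <= e.
  move=> fv fw.
  have [gam [_ gam0 gam1 Hgam]] := H v w.
  have [|_] := Hgam t; first by rewrite !ltW.
  rewrite gam0 gam1 => fg.
  case Ev : (f v) (fNy v) fv fg => [x|//|//] _; rewrite lte_fin => xe fg.
  case Ew : (f w) (fNy w) fw fg => [y|//|//] _; rewrite lte_fin => ye.
  move=> /(le_trans (rf _)); rewrite -!EFinM -!EFinD lee_fin -/c.
  have : (1 - t) * x <= (1 - t) * (r + e) by rewrite ler_pM2l ?subr_gt0// ltW.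
  have : t * y <= t * (r + e) by rewrite ler_pM2l// ltW.
  lra.
have /cauchy_cvg/cvg_ex[v Fv] : cauchy F.
  apply: cauchy_exP => eps eps0.
  have e0 : 0 < c * (eps / 2) `^ p0 by rewrite mulr_gt0// powR_gt0// divr_gt0.
  have : (ereal_inf (range f) < (r + c * (eps / 2) `^ p0)%:E)%E by rewrite E lte_fin; lra.
  move=> /ereal_inf_lt[_ [w _ <-] we]; exists w.
  exists (c * (eps / 2) `^ p0) => // v /= ve.
  have := close _ _ _ we ve; rewrite ler_pM2l// => le1.
  rewrite ballEmdist/= ltNge; apply/negP => le2.
  have : (eps / 2) `^ p0 < mdist w v `^ p0.
    by apply: gt0_ltr_powR; rewrite ?nnegrE ?mdist_ge0//; lra.
  by rewrite ltNge le1.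
exists v => w; apply: le_trans (rf w).
apply/lee_addgt0Pr => e e0; rewrite leNgt; apply/negP => /flsc[V Vv VP].
have : F (V `&` [set v | (f v < (r + e)%:E)%E]).
  by apply: filterI; [exact: Fv | exists e].
move=> /filter_ex[x [/VP xV]] /=; rewrite EFinD => /(lt_trans xV).
by rewrite ltxx.
Qed.

End minimizers.

(** * Curves of maximal slope *)

Section regularity.
Context {R : realType} {S : metricType R}.
Variables (f : S -> \bar R) (u : R -> S) (a : \bar R) (p q : R).
Hypotheses (p1 : 1 < p) (pq : p^-1 + q^-1 = 1).
Hypothesis f_fin : forall t, co_itv a t -> f (u t) = (real_energy f u t)%:E.
Let E := real_energy f u.
Let G t := local_slope f (u t).

(** The definition of the slope gives [- E' <= G |u'|], and the defining inequality
    gives [|u'|^p / p + G^q / q <= - E']. Young's inequality closes the circle. *)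
Lemma CMS_regular t : co_itv a t ->
  derivable E t 1 ->
  (exists2 l : R, is_metric_derivative u t l &
   ((derive1 E t)%:E <= - (p^-1 * l `^ p)%:E - (q^-1)%:E * local_slope f (u t) `^ q)%E) ->
  regular_point u E G p q t.
Proof.
move=> at_ dE [l ul]; set D := derive1 E t => DE.
have pp := exponent_gt0 p1; have q0 := conj_exponent_gt0 p1 pq.
have [g [g0 Gg]] : exists g, 0 <= g /\ local_slope f (u t) = g%:E.
  case Gt : (local_slope f (u t)) (slope_ge0 f (u t)) DE => [g| |//].
    by rewrite lee_fin => g0 _; exists g.
  by rewrite poweRyr ?gt_eqF// gt0_muley ?lte_fin ?invr_gt0// addeNy leeNy_eq.
have Eh : (E (t + h) - E t) / h @[h --> 0^'+] --> D.
  have dE' : h^-1 *: ((E \o shift t) (h *: 1) - E t) @[h --> 0^'] --> D.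
    by rewrite /D derive1E; exact: dE.
  rewrite (_ : (fun h => _) = (fun h => h^-1 *: ((E \o shift t) (h *: 1) - E t))).
    exact: cvg_dnbhs_at_right.
  apply/funext => h /=.
  by rewrite /GRing.scale/= mulr1 mulrC (addrC h).
have uh : mdist (u t) (u (t + h)) / h @[h --> 0^'+] --> l.
  apply/cvgrPdist_lt => e e0.
  have /cvgrPdist_lt/(_ e e0) ulP := ul.
  have := near_at_right_shift ulP; apply: filterS2 (nbhs_right_gt (0 : R)) => h h0.
  have -> : t - (t + h) = - h by rewrite opprD addrA subrr sub0r.
  by rewrite [X in _ / X]normrN [X in _ / X]gtr0_norm.
have l0 : 0 <= l.
  rewrite leNgt; apply/negP => l0.
  near (0 : R)^'+ => h.
  have h0 : 0 < h by near: h; exact: nbhs_right_gt.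
  have : mdist (u t) (u (t + h)) / h < 0 by near: h; exact: (cvgr_lt _ uh).
  by rewrite ltNge divr_ge0 ?mdist_ge0// ltW.
move: DE; rewrite Gg poweR_EFin -EFinM -!EFinN -EFinD lee_fin => DE.
have Dgl : - D <= g * l.
  apply/ler_addgt0Pr => e e0.
  pose e' := e / (l + 1).
  have e'0 : 0 < e' by rewrite divr_gt0// ltr_wpDl.
  have [|d d0 dP] := slope_lt_near (f_fin at_) (g' := g + e'); first by rewrite Gg lte_fin; lra.
  apply: (@le_trans _ _ ((g + e') * l)); last first.
    have : e' * (l + 1) = e by rewrite divfK// gt_eqF// ltr_wpDl.
    lra.
  rewrite leNgt; apply/negP => lt1.
  have l10 : 0 < l + 1 by lra.
  have [T aT nT] := near_right_co at_.
  have lim1 : (g + e') * (mdist (u t) (u (t + h)) / h) + (E (t + h) - E t) / h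
      @[h --> 0^'+] --> (g + e') * l + D.
    by apply: cvgD => //; apply: cvgM => //; exact: cvg_cst.
  have neg : (g + e') * l + D < 0 by lra.
  have hd : \forall h \near 0^'+, h < d / (l + 1) by apply: nbhs_right_lt; rewrite divr_gt0.
  have ul1 : \forall h \near 0^'+, mdist (u t) (u (t + h)) / h < l + 1.
    by apply: (cvgr_lt _ uh); lra.
  near (0 : R)^'+ => h.
  have [h0 hT] : 0 < h /\ t + h <= T by near: h.
  have hdl : h < d / (l + 1) by near: h.
  have ul2 : mdist (u t) (u (t + h)) / h < l + 1 by near: h.
  have : (g + e') * (mdist (u t) (u (t + h)) / h) + (E (t + h) - E t) / h < 0.
    by near: h; exact: (cvgr_lt _ lim1).
  have ath : co_itv a (t + h) by apply: co_itv_le aT _ _ => //; have := at_.1; lra.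
  have dd : mdist (u t) (u (t + h)) < d.
    move: ul2 hdl; rewrite ltr_pdivrMr// ltr_pdivlMr// => ul2 hdl.
    by apply: (lt_trans ul2); rewrite mulrC.
  rewrite mulrA -mulrDl ltr_pdivrMr// mul0r.
  by have := dP _ _ dd (f_fin ath); rewrite -/E; lra.
have lg : l `^ p = g `^ q.
  by apply: young_eq p1 pq l0 g0 _; rewrite mulrC in Dgl; lra.
have Dg : D <= - g `^ q.
  have : l `^ p / p + g `^ q / q = g `^ q by rewrite lg -mulrDr pq mulr1.
  lra.
exists (g `^ q), l; split; rewrite ?lg//.
- by rewrite /G Gg poweR_EFin.
- move=> e e0.
  have : \forall h \near 0^'+, (E (t + h) - E t) / h < D + e.
    by apply: (cvgr_lt _ Eh); lra.
  apply: filterS2 (nbhs_right_gt 0) => h h0; rewrite ltr_pdivrMr//.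
  have : D * h <= - g `^ q * h by rewrite ler_pM2r.
  lra.
- move=> e e0.
  have : \forall h \near 0^'+, mdist (u t) (u (t + h)) / h < l + e.
    by apply: (cvgr_lt _ uh); lra.
  by apply: filterS2 (nbhs_right_gt 0) => h h0; rewrite ltr_pdivrMr// => /ltW.
Unshelve. all: end_near.
Qed.

End regularity.

Section maximal_slope.
Context {R : realType} {S : completeMetricType R}.
Variables (f : S -> \bar R) (u0 : S) (a : \bar R) (lambda p0 q0 p q : R) (u : R -> S).
Hypotheses (f_gtNy : forall v, (-oo < f v)%E) (f_proper : eproper f)
  (f_lsc : lower_semicontinuous f) (u0_dom : edom f u0) (a_gt0 : (0 < a)%E)
  (cases : [/\ 0 <= lambda, 1 < p0 & 1 < p] \/
           [/\ lambda < 0, 2 <= p0, 1 < p & p <= p0])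
  (pq : p^-1 + q^-1 = 1)
  (f_convex : plambda_convex p0 lambda f)
  (u_CMS : CMS p q f a u0 u).

Let E := real_energy f u.
Let G t := local_slope f (u t).
Let kap := Num.max 0 (- lambda).

Lemma CMS_p_gt1 : 1 < p. Proof. by case: cases => -[]. Qed.

Lemma CMS_p0_gt1 : 1 < p0. Proof. by case: cases => -[] //; lra. Qed.

Lemma CMS_kap : kap = 0 \/ p <= p0.
Proof.
case: cases => -[h1 h2 h3]; last by right.
by left; rewrite /kap max_l// oppr_le0.
Qed.

Lemma CMS_co0 : co_itv a 0. Proof. by split. Qed.

Lemma CMS_energyE t : co_itv a t -> f (u t) = (E t)%:E.
Proof.
move=> at_; have [_ u00 mono _] := u_CMS.
have : (f (u t) < +oo)%E.
  by apply: le_lt_trans (mono _ _ CMS_co0 at_ at_.1) _; rewrite u00.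
by rewrite /E /real_energy; case: (f (u t)) (f_gtNy (u t)).
Qed.

Lemma CMS_energy_dec s t : co_itv a s -> co_itv a t -> s <= t -> E t <= E s.
Proof.
move=> as_ at_ st; have [_ _ mono _] := u_CMS.
by have := mono _ _ as_ at_ st; rewrite !CMS_energyE// lee_fin.
Qed.

Lemma CMS_energy_curve : energy_curve u E G a p q.
Proof.
split; [by case: u_CMS | exact: CMS_energy_dec |].
have [_ _ _ ae] := u_CMS; apply: negligibleS ae => x [ax nr] /= /(_ ax)[dE dl].
exact: nr (CMS_regular CMS_p_gt1 pq CMS_energyE ax dE dl).
Qed.

Lemma CMS_drop s t g : co_itv a s -> co_itv a t -> G s = g%:E ->
  E s - E t <= g * mdist (u s) (u t) + kap * mdist (u s) (u t) `^ p0.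
Proof.
move=> as_ at_ Gs; apply: (slope_global_upper f_gtNy _ f_convex (CMS_energyE as_)).
- by rewrite (lt_trans _ CMS_p0_gt1).
- by rewrite CMS_energyE.
- by rewrite -Gs.
Qed.

(** Only [u] restricted to [[0,a)] is continuous, so lower semicontinuity is
    stated for times in that interval. *)
Lemma CMS_slope_power_lsc x c : co_itv a x -> (c%:E < G x `^ q)%E ->
  exists2 d : R, 0 < d & forall y, co_itv a y -> `|y - x| < d -> (c%:E < G y `^ q)%E.
Proof.
move=> ax; have q_0 := conj_exponent_gt0 CMS_p_gt1 pq.
have [c0|c0] := ltP c 0.
  exists 1; first exact: ltr01.
  by move=> y _ _; rewrite (lt_le_trans _ (poweR_ge0 _ _))// lte_fin.
have cE : c = (c `^ q^-1) `^ q by rewrite -powRrM mulVf ?gt_eqF// powRr1.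
rewrite {1}cE poweR_lt ?powR_ge0 ?slope_ge0//.
move=> /(local_slope_lsc f_gtNy CMS_p0_gt1 f_convex f_lsc)[V Vx VP].
have [e /= e0 eV] := (metricType_numDomainType.nbhs_mdistP _ _).1 Vx.
have [d d0 dP] := curve_continuous CMS_p_gt1 pq CMS_energy_curve ax e0.
exists d => // y ay yx; rewrite cE poweR_lt ?powR_ge0 ?slope_ge0//.
by apply: VP; apply: eV; exact: dP.
Qed.

Lemma CMS_slope_curve : slope_curve u E G a p q kap p0.
Proof.
split; [exact: CMS_energy_curve | by rewrite le_max lexx | exact: CMS_kap | | |].
- by move=> t; exact: slope_ge0.
- exact: CMS_drop.
- exact: CMS_slope_power_lsc.
Qed.

Lemma CMS_slope_fin t : (G t < +oo)%E -> exists2 g, 0 <= g & G t = g%:E.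
Proof.
case: (G t) (slope_ge0 f (u t) : (0 <= G t)%E) => [g|//|//].
by rewrite lee_fin => g0 _; exists g.
Qed.

Lemma CMS_slope_lty t : oo_itv a t -> (G t < +oo)%E.
Proof.
move=> at_.
have [eta eta0 Ht] := slope_finite CMS_p_gt1 pq CMS_slope_curve at_.
have [g [_ -> _]] := slope_power_finite CMS_p_gt1 pq CMS_slope_curve Ht; exact: ltry.
Qed.

Lemma CMS_right_energy_identity t : co_itv a t -> (G t < +oo)%E ->
  right_energy_identity p q f u t.
Proof.
move=> at_ /CMS_slope_fin[g g0 Gt]; have q_0 := conj_exponent_gt0 CMS_p_gt1 pq; have q_1 := conj_exponent_gt1 CMS_p_gt1 pq.
have Ht : (G t `^ q)%E = (g `^ q)%:E by rewrite Gt poweR_EFin.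
exists (- g `^ q), (g `^ (q - 1)); split.
- have := energy_right_derivative CMS_p_gt1 pq CMS_slope_curve at_ Ht.
  move=> /cvgN; rewrite /is_right_derivative.
  rewrite (_ : - (fun h => _) = (fun h => (E (t + h) - E t) / h))//.
  by apply/funext => h; rewrite /GRing.opp/= -mulNr opprB.
- exact: (metric_right_derivative CMS_p_gt1 pq CMS_slope_curve at_ g0 Gt).
- by rewrite -/(G t) Gt -EFinM -EFinN mulr_powRB1.
- by rewrite -powRrM (conj_exponentE q_1) 1?addrC.
- by rewrite -/(G t) Gt poweR_EFin -EFinN.
Qed.

Lemma CMS_slope_right_cvg t : co_itv a t -> G t' @[t' --> t^'+] --> G t.
Proof. exact: (slope_right_continuous CMS_p_gt1 pq CMS_slope_curve). Qed.

Lemma CMS_lipschitz t : oo_itv a t -> exists L : R, exists2 V, nbhs t V &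
  forall s1 s2, (co_itv a `&` V) s1 -> (co_itv a `&` V) s2 ->
    `|E s1 - E s2| <= L * `|s1 - s2| /\ mdist (u s1) (u s2) <= L * `|s1 - s2|.
Proof.
move=> /(slope_curve_lipschitz CMS_p_gt1 pq CMS_slope_curve)[L [V Vt LV]].
exists L, V => // s1 s2 V1 V2.
have [s12|s12|<-] := ltgtP s1 s2.
- rewrite ger0_norm ?subr_ge0 ?(CMS_energy_dec V1.1 V2.1 (ltW s12))//.
  by rewrite distrC gtr0_norm ?subr_gt0//; exact: LV.
- rewrite distrC ger0_norm ?subr_ge0 ?(CMS_energy_dec V2.1 V1.1 (ltW s12))//.
  by rewrite gtr0_norm ?subr_gt0// metric_sym; exact: LV.
by rewrite !subrr normr0 mulr0 mdistxx.
Qed.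

Lemma CMS_kap_eq0 : 0 <= lambda -> kap = 0.
Proof. by move=> l0; rewrite /kap max_l// oppr_le0. Qed.

Lemma CMS_slope_nonincreasing s t : 0 <= lambda ->
  co_itv a s -> co_itv a t -> s <= t -> (G t <= G s)%E.
Proof.
move=> l0 as_ at_; rewrite le_eqVlt => /predU1P[->//|st].
have := slope_power_nonincreasing CMS_p_gt1 pq CMS_slope_curve (CMS_kap_eq0 l0) at_ as_.1 st.
have q_0 := conj_exponent_gt0 CMS_p_gt1 pq.
case Gs : (G s) (slope_ge0 f (u s) : (0 <= G s)%E) => [g| |//]; last by move=> *; rewrite leey.
rewrite lee_fin => g0 Hts; rewrite leNgt; apply/negP => gG.
move: Hts; rewrite leNgt poweR_EFin.
by rewrite poweR_lt ?slope_ge0// gG.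
Qed.

(** As the slope is nonincreasing, [G(t)^q (t - t0)] is at most the energy lost
    on [[t0,t]]. For the second bound, [u t] is a competitor in the infimum whose
    penalty is at most the fraction [1 / p] of the energy lost. *)
Lemma CMS_slope_decay t0 t : 0 <= lambda -> co_itv a t0 -> co_itv a t -> t0 < t ->
     (G t `^ q <= (f (u t0) - ereal_inf (range f)) * ((t - t0)^-1)%:E)%E /\
     ((q^-1)%:E * G t `^ q
        <= (f (u t0) - moreau_yosida p f (t - t0) (u t0)) * ((t - t0)^-1)%:E)%E.
Proof.
move=> l0 at0 at_ t0t.
have h0 : 0 < t - t0 by rewrite subr_gt0.
have q_0 := conj_exponent_gt0 CMS_p_gt1 pq; have pp := exponent_gt0 CMS_p_gt1.
have ot : oo_itv a t by split; [exact: le_lt_trans at0.1 t0t | exact: at_.2].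
have [g g0 Gt] := CMS_slope_fin (CMS_slope_lty ot).
have Ht : (G t `^ q)%E = (g `^ q)%:E by rewrite Gt poweR_EFin.
have D : g `^ q * (t - t0) <= E t0 - E t.
  apply: (slope_power_le_drop CMS_p_gt1 pq CMS_slope_curve (CMS_kap_eq0 l0) at_ at0.1 t0t).
  by rewrite Ht.
rewrite Gt poweR_EFin -EFinM !lee_pdivlMr// -!EFinM (CMS_energyE at0); split.
  apply: (@le_trans _ _ ((E t0)%:E - (E t)%:E)%E); first by rewrite -EFinB lee_fin.
  apply: leeB => //; apply: ereal_inf_lbound; exists (u t) => //; exact: CMS_energyE.
set W := mdist (u t0) (u t) `^ p / (p * (t - t0) `^ (p - 1)).
apply: (@le_trans _ _ ((E t0)%:E - ((E t)%:E + W%:E))%E); last first.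
  apply: leeB => //; apply: ereal_inf_lbound; exists (u t) => //=.
  by rewrite CMS_energyE.
rewrite -!EFinD lee_fin.
have P1 : 0 < (t - t0) `^ (p - 1) by rewrite powR_gt0.
have WD : W <= (E t0 - E t) / p.
  rewrite /W invfM mulrA mulrAC ler_pM2r ?invr_gt0// ler_pdivrMr//.
  exact: (dist_powR_le CMS_p_gt1 pq CMS_energy_curve at_ at0.1 t0t).
have : q^-1 * (g `^ q * (t - t0)) <= q^-1 * (E t0 - E t) by rewrite ler_pM2l ?invr_gt0.
have -> : q^-1 = 1 - p^-1 by move: pq; lra.
lra.
Qed.

(** The first inequality is the growth of [f] at its minimizer. The second is
    the global slope inequality at [u t], maximized over the distance. *)
Lemma CMS_minimizer : p0^-1 + q0^-1 = 1 -> 0 < lambda ->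
     exists ubar : S, unique (minimizer f) ubar /\
       forall t, oo_itv a t ->
         ((lambda * mdist (u t) ubar `^ p0)%:E <= f (u t) - f ubar)%E /\
         (f (u t) - f ubar
            <= ((q0 * lambda `^ (q0 / p0))^-1)%:E
               * local_slope f (u t) `^ q0)%E.
Proof.
move=> pq0 l0; have p01 := CMS_p0_gt1; have p00 := exponent_gt0 p01.
have slope_drop t w y g : co_itv a t -> 0 <= g -> G t = g%:E -> (f w <= y%:E)%E ->
    E t - y <= (q0 * lambda `^ (q0 / p0))^-1 * g `^ q0.
  move=> at_ g0 Gt fw; apply: le_trans (young_le p01 pq0 l0 g0 (mdist_ge0 (u t) w)).
  by apply: (slope_global f_gtNy p00 f_convex (CMS_energyE at_) fw); rewrite -/(G t) Gt.
have [t1 at1 t1_gt0] := co_itv_right CMS_co0.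
have ot1 : oo_itv a t1 by split => //; exact: at1.2.
have [g1 g10 Gt1] := CMS_slope_fin (CMS_slope_lty ot1).
have [ubar umin] : exists v, minimizer f v.
  apply: (exists_minimizer f_gtNy p00 l0 f_convex f_lsc f_proper
    (r0 := E t1 - (q0 * lambda `^ (q0 / p0))^-1 * g1 `^ q0)) => w.
  case fw : (f w) (f_gtNy w) => [y| |//]; last by move=> *; rewrite leey.
  have := slope_drop t1 w y g1 at1 g10 Gt1; rewrite fw lexx lee_fin => /(_ isT); lra.
have fub : (f ubar < +oo)%E by apply: le_lt_trans (umin u0) _; exact: u0_dom.
have [x fx] : exists x, f ubar = x%:E.
  by case: (f ubar) (f_gtNy ubar) fub => [x|//|//]; exists x.
exists ubar; split.
  split => // v vmin.
  have := minimizer_growth f_gtNy p00 f_convex umin fx (w := v) (y := x).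
  rewrite -fx (vmin ubar) subrr => /(_ isT) d0.
  apply: mdist_positivity; apply/eqP; rewrite eq_le mdist_ge0 andbT leNgt; apply/negP => dpos.
  by move: d0; rewrite leNgt mulr_gt0// powR_gt0.
move=> t ot.
have at_ := oo_itv_co ot.
have [g g0 Gt] := CMS_slope_fin (CMS_slope_lty ot).
rewrite -/(G t) Gt fx (CMS_energyE at_) poweR_EFin -EFinB -EFinM !lee_fin; split.
  rewrite metric_sym; apply: (minimizer_growth f_gtNy p00 f_convex umin fx).
  by rewrite CMS_energyE.
by apply: (slope_drop t ubar) => //; rewrite fx.
Qed.

End maximal_slope.

Theorem theorem1p7 (R : realType) (S : completeMetricType R) (f : S -> \bar R)
  (u0 : S) (a : \bar R) (lambda p0 q0 p q : R) (u : R -> S)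
  (f_gtNy : forall v, (-oo < f v)%E)
  (f_proper : eproper f)
  (f_lsc : lower_semicontinuous f)
  (u0_dom : edom f u0)
  (a_gt0 : (0 < a)%E)
  (cases : [/\ 0 <= lambda, 1 < p0 & 1 < p] \/
           [/\ lambda < 0, 2 <= p0, 1 < p & p <= p0])
  (conj_pq : p^-1 + q^-1 = 1)
  (conj_p0q0 : p0^-1 + q0^-1 = 1)
  (f_convex : plambda_convex p0 lambda f)
  (u_CMS : CMS p q f a u0 u) :
  (* (i) *)
  [/\ locally_lipschitz u (oo_itv a),
      locally_lipschitz (real_energy f u : R -> R^o) (oo_itv a) &
      forall t, oo_itv a t -> edom (local_slope f) (u t)]
  /\
  (* (ii) *)
  [/\ forall t, oo_itv a t -> right_energy_identity p q f u t,
      edom (local_slope f) u0 -> right_energy_identity p q f u 0,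
      exists A : set R,
        [/\ A `<=` co_itv a,
            lebesgue_measure.-negligible (co_itv a `\` A),
            forall t, oo_itv a t -> slope_right_cvg f u A t &
            edom (local_slope f) u0 -> slope_right_cvg f u A 0] &
      0 <= lambda ->
        (forall s t, co_itv a s -> co_itv a t -> s <= t ->
           (local_slope f (u t) <= local_slope f (u s))%E) /\
        (forall t, co_itv a t ->
           local_slope f (u t') @[t' --> t^'+] --> local_slope f (u t))]
  /\
  (* (iii) *)
  (0 <= lambda -> forall t0 t, co_itv a t0 -> co_itv a t -> t0 < t ->
     (local_slope f (u t) `^ q
        <= (f (u t0) - ereal_inf (range f)) * ((t - t0)^-1)%:E)%E /\
     ((q^-1)%:E * local_slope f (u t) `^ q
        <= (f (u t0) - moreau_yosida p f (t - t0) (u t0)) * ((t - t0)^-1)%:E)%E)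
  /\
  (* (iv) *)
  (0 < lambda ->
     exists ubar : S, unique (minimizer f) ubar /\
       forall t, oo_itv a t ->
         ((lambda * mdist (u t) ubar `^ p0)%:E <= f (u t) - f ubar)%E /\
         (f (u t) - f ubar
            <= ((q0 * lambda `^ (q0 / p0))^-1)%:E
               * local_slope f (u t) `^ q0)%E).
Proof.
have slope_oo t : oo_itv a t -> edom (local_slope f) (u t).
  exact: (CMS_slope_lty f_gtNy f_lsc u0_dom a_gt0 cases conj_pq f_convex u_CMS).
have lip := CMS_lipschitz f_gtNy f_lsc u0_dom a_gt0 cases conj_pq f_convex u_CMS.
have ident := CMS_right_energy_identity f_gtNy f_lsc u0_dom a_gt0 cases conj_pq f_convex u_CMS.
have rcvg := CMS_slope_right_cvg f_gtNy f_lsc u0_dom a_gt0 cases conj_pq f_convex u_CMS.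
have u00 : u 0 = u0 by case: u_CMS.
have a0 : co_itv a 0 by [].
have wcvg t : co_itv a t -> slope_right_cvg f u (co_itv a) t.
  by move=> at_; apply: cvg_trans (rcvg t at_); apply: cvg_app; exact: cvg_within.
split; [|split; [|split]].
- split => //.
    move=> t /lip [L [V Vt LV]]; exists L, V => // s1 s2 [so1 V1] [so2 V2].
    by have [] := LV s1 s2 (conj (oo_itv_co so1) V1) (conj (oo_itv_co so2) V2).
  move=> t /lip [L [V Vt LV]]; exists L, V => // s1 s2 [so1 V1] [so2 V2].
  by have [+ _] := LV s1 s2 (conj (oo_itv_co so1) V1) (conj (oo_itv_co so2) V2); rewrite distrC.
- split.
  + by move=> t ot; apply: ident; [exact: oo_itv_co | exact: slope_oo].
  + by move=> du0; apply: (ident 0 a0); rewrite u00.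
  + exists (co_itv a); split => //.
      by rewrite setDv; exact: negligible_set0.
      by move=> t /oo_itv_co /wcvg.
    by move=> _; exact: wcvg.
  + move=> l0; split=> [s t|t at_]; last exact: rcvg.
    exact: (CMS_slope_nonincreasing f_gtNy f_lsc u0_dom a_gt0 cases conj_pq f_convex u_CMS l0).
- by move=> l0 t0 t; exact: (CMS_slope_decay f_gtNy f_lsc u0_dom a_gt0 cases conj_pq f_convex u_CMS l0).
exact: (CMS_minimizer f_gtNy f_proper f_lsc u0_dom a_gt0 cases conj_pq f_convex u_CMS conj_p0q0).
Qed.
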